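(* Let $(\mathcal K,\tau)$ be a Hausdorff geometric structure. Let $\mathcal M=(M,\dots)$ be a non-locally modular strongly minimal definable $\mathcal K$-relic such that: every $\emptyset$-definable set in $\mathcal M$ is $\emptyset$-definable in $\mathcal K$; the language of $\mathcal M$ is countable; $\operatorname{acl}_{\mathcal M}(\emptyset)$ is infinite; and there is a $\emptyset$-definable excellent family of plane curves in $\mathcal M$. Assume that $\mathcal M$ detects multiple intersections, and that $(\mathcal K,\tau)$ has ramification purity. Then $\dim(M)=1$ in the sense of $\mathcal K$.
   Context: **Geometric structures.** Definable means definable with parameters, without imaginary sorts; interpretable means definable in $\mathcal K^{eq}$. A complete theory is geometric if in its models $\operatorname{acl}$ satisfies exchange and the theory eliminates $\exists^\infty$; a structure is geometric if its theory is. All parameter sets $A,B,\dots$ are countable. In an $\aleph_1$-saturated geometric structure $\mathcal K$: $\dim(a/A)$ is the length of a maximal subtuple of the finite tuple $a$ that is $\operatorname{acl}$-independent over $A$; for $A$-definable $X$, $\dim X=\max\{\dim(x/A):x\in X\}$; $a,b$ are independent over $A$ if $\dim(ab/A)=\dim(a/A)+\dim(b/A)$; $a\in X$ is generic in $X$ over $A$ if $\dim(a/A)=\dim X$. Dimension extends to tuples and sets of $\mathcal K^{eq}$ (following Gagelman) preserving additivity. **Hausdorff geometric structures.** Let $\mathcal K=(K,\dots)$ be a structure in a language $\mathcal L$ and $\tau$ a topology on $K$; each $K^n$ has the product topology and definable sets the subspace topology. $(\mathcal K,\tau)$ is a Hausdorff geometric structure if: (1) $\tau$ is Hausdorff; (2)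 $\mathcal K$ is geometric and $\aleph_1$-saturated ($\mathcal L$ may be uncountable); (3) if $X\subset K^n$ is definable over $A$ and $a\in\overline{\operatorname{Fr}(X)}$, where $\operatorname{Fr}(X)=\overline X\setminus X$, then $\dim(a/A)<\dim X$; (4) if $X\subset K^n$ is definable over countable $A$, $a\in X$ is generic over $A$, and $B\supset A$ is countable, then every neighborhood of $a$ contains a generic of $X$ over $B$; (5) if $X,Y$ and $Z\subset X\times Y$ are $A$-definable of the same dimension, $Z\to X$ and $Z\to Y$ are finite-to-one, and $(x,y)\in Z$ is generic over $A$, then there are open neighborhoods $U$ of $x$ in $X$ and $V$ of $y$ in $Y$ such that $Z\cap(U\times V)$ is the graph of a homeomorphism $U\to V$. **Relics and families.** A $\mathcal K$-relic is a structure $\mathcal M=(M,\dots)$ such that $M$ and all $\mathcal M$-definable subsets of powers of $M$ are interpretable in $\mathcal K$; it is definable if $M\subset K^n$ for some $n$. A structure is strongly minimal if in all elementary extensions every definable set in one variable is finite or cofinite; $\operatorname{rk}$ is Morley rank in $\mathcal M$. A plane curve is an $\mathcal M$-definable subset of $M^2$ of rank 1; it is non-trivial if both its projections to $M$ are finite-to-one. A definable family $\{X_t:t\in T\}$ is almost faithful if all $X_t$ have the same rank $d$ and for each $t$ only finitely many $t'$ satisfy $\operatorname{rk}(X_t\cap X_{t'})=d$. A strongly minimal structure is not locally modular if it admits a definable almost faithful family of plane curves with $\operatorname{rk}(T)=2$. An almost faithful family $\{C_t:t\in T\}$ of plane curves is excellent if $T$ is a generic (rank 2) subset of $M^2$,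 each $C_t$ is non-trivial, and for each $p\in M^2$ the set $\{t\in T:p\in C_t\}$ is empty or a non-trivial plane curve. In the following ''generic'' and ''independent'' are in the sense of $\mathcal K$; for relic notions parameter sets are countable sets of tuples from $\mathcal M^{eq}$; $\mathcal M(A)$- and $\mathcal K(A)$-definable mean definable over $A$ in $\mathcal M$, resp. $\mathcal K$; $a,b$ are $\mathcal M$-independent over $A$ if $\operatorname{rk}(ab/A)=\operatorname{rk}(a/A)+\operatorname{rk}(b/A)$, and $\mathcal M$-dependent otherwise. A standard family of plane curves over $A$ is an almost faithful $\mathcal M(A)$-definable family of plane curves $\{C_t:t\in T\}$ such that $\operatorname{rk}(T)\ge1$, $T$ is a generic subset of $M^{\operatorname{rk}(T)}$ (i.e. of full rank), and for each $x\in M^2$ the set $\{t\in T:x\in C_t\}$ has rank at most $\operatorname{rk}(T)-1$. **Generic intersections.** Let $\mathcal Y=\{Y_t:t\in T\}$, $\mathcal Z=\{Z_u:u\in U\}$ be $\mathcal K(A)$-definable families of subsets of a $\mathcal K(A)$-definable set $X$, with graphs $Y=\{(x,t):x\in Y_t\}$, $Z=\{(x,u):x\in Z_u\}$. A weakly generic $(\mathcal Y,\mathcal Z)$-intersection over $A$ is a tuple $(x,t,u)$ such that $x\in X$, $t\in T$, $u\in U$, $(x,t)\in Y$, $(x,u)\in Z$ are all generic over $A$. It is strongly generic over $A$ if moreover $t$ and $u$ are independent over both $A$ and $Ax$; it is strongly approximable over $A$ if every neighborhood of $(x,t,u)$ contains a strongly generic $(\mathcal Y,\mathcal Z)$-intersection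 over $A$. For a function $f:X\to Y$ with $X\subset K^m$, $Y\subset K^n$, $x_0\in X$ is a topological ramification point of $f$ if $(x_0,x_0)$ is in the closure of $\{(x,x')\in X^2:x\ne x', f(x)=f(x')\}$. A weakly generic intersection $(x,t,u)$ over $A$ is a generic multiple $(\mathcal Y,\mathcal Z)$-intersection over $A$ if it is a topological ramification point of the projection $I\to T\times U$, where $I=\{(x',t',u'):(x',t')\in Y,(x',u')\in Z\}$. The codimension over $A$ is $\operatorname{codim}_A(x,t,u)=\dim(t/Ax)+\dim(u/Ax)-\dim(tu/Ax)$. **The hypotheses.** $\mathcal M$ detects multiple intersections if, whenever $\mathcal C=\{C_t:t\in T\}$ and $\mathcal D=\{D_u:u\in U\}$ are standard families of plane curves over $A$ and $(x,t,u)$ is a generic multiple $(\mathcal C,\mathcal D)$-intersection over $A$ (with ambient set $X=M^2$), $t$ and $u$ are $\mathcal M$-dependent over $A$. $(\mathcal K,\tau)$ has ramification purity if, for every countable parameter set $A$, every $\mathcal K(A)$-definable set $X$, and all $\mathcal K(A)$-definable families $\mathcal Y=\{Y_t:t\in T\}$ and $\mathcal Z=\{Z_u:u\in U\}$ of subsets of $X$: if there is a generic multiple $(\mathcal Y,\mathcal Z)$-intersection over $A$ which is strongly approximable over $A$, then there is a generic multiple $(\mathcal Y,\mathcal Z)$-intersection over $A$ of codimension at most 1 over $A$. *)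

(* Defs.v *)
From HB Require Import structures.
From mathcomp Require Import all_boot.
From mathcomp Require Import all_classical.
From mathcomp Require Import topology.

Set Implicit Arguments.
Unset Strict Implicit.
Unset Printing Implicit Defensive.

Local Open Scope classical_set_scope.

Record language := Language {
  fun_symbol : Type;
  fun_arity : fun_symbol -> nat;
  rel_symbol : Type;
  rel_arity : rel_symbol -> nat }.

Definition countable_language (L : language) : Prop :=
  countable [set: fun_symbol L] /\ countable [set: rel_symbol L].

(* [structure L T] is the type of L-structures with universe T. *)
Record structure (L : language) (T : Type) := Structure {
  interp_fun : forall f : fun_symbol L, ('I_(fun_arity f) -> T) -> T;
  interp_rel : forall r : rel_symbol L, ('I_(rel_arity r) -> T) -> Prop }.

Section Syntax.
Variable L : language.

Inductive term (V : Type) : Type :=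
| Var : V -> term V
| App : forall f : fun_symbol L, ('I_(fun_arity f) -> term V) -> term V.

(* Formulas with free variables in V; the variable bound by [All] is None. *)
Inductive formula (V : Type) : Type :=
| Falsum : formula V
| Equal : term V -> term V -> formula V
| Atom : forall r : rel_symbol L, ('I_(rel_arity r) -> term V) -> formula V
| Imp : formula V -> formula V -> formula V
| All : formula (option V) -> formula V.

Variables (T : Type) (S : structure L T).

Fixpoint eval (V : Type) (v : V -> T) (t : term V) : T :=
  match t with
  | Var i => v i
  | App f ts => interp_fun S (fun j => eval v (ts j))
  end.

Fixpoint sat (V : Type) (phi : formula V) : (V -> T) -> Prop :=
  match phi with
  | Falsum => fun=> False
  | Equal s t => fun v => eval v s = eval v t
  | Atom r ts => fun v => interp_rel S (fun j => eval v (ts j))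
  | Imp phi1 phi2 => fun v => sat phi1 v -> sat phi2 v
  | All phi1 => fun v => forall x : T, sat phi1 (oapp v x)
  end.

End Syntax.

Section Maps.
Variables (L : language) (T T' : Type) (S : structure L T) (S' : structure L T').

Definition elementary (h : T -> T') : Prop :=
  forall (V : Type) (phi : formula L V) (v : V -> T),
    sat S phi v <-> sat S' phi (h \o v).

Definition elementarily_equivalent : Prop :=
  forall phi : formula L void, sat S phi (of_void T) <-> sat S' phi (of_void T').

End Maps.

(* Powers T^n are written I -> T for an arbitrary finite index type I, so that
   the concatenation of an I-tuple and a J-tuple is an (I + J)-tuple. *)

Definition tcat (I J : Type) (T : Type) (x : I -> T) (y : J -> T) : I + J -> T :=
  fun k => match k with inl i => x i | inr j => y j end.

(* The subset of T^(I+J) corresponding to a subset of T^I x T^J. *)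
Definition joint (I J : Type) (T : Type) (Z : set ((I -> T) * (J -> T))) :
    set (I + J -> T) :=
  [set z : I + J -> T | Z (z \o inl, z \o inr)].

(* An element of T^eq is an equivalence class of a 0-definable equivalence
   relation on some T^k.  It is represented by k and the class itself, as a
   subset of T^k; see [imaginary] below.  The element a of T is the class {a}
   of equality on T^1. *)
Definition eqclass (T : Type) := {k : nat & set ('I_k -> T)}.

Definition real_point (T : Type) (a : T) : eqclass T :=
  existT _ 1 [set fun=> a].

Definition reals (T : Type) (A : set T) : set (eqclass T) := @real_point T @` A.

Section Definability.
Variables (L : language) (T : Type) (S : structure L T).

(* Definability of X over a set A of elements of T^eq.  A formula of L^eq in
   real free variables refers to a parameter e only through quantification over
   the representatives of e: X is the set of x such that phi(x, c) holds for
   some choice c of a representative of each e in A.  (Only finitely many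
   parameters occur in phi.)  If A = reals A0 then c is unique, and this is
   ordinary definability over A0. *)
Definition definable_over (A : set (eqclass T)) (I : finType) (X : set (I -> T)) :
    Prop :=
  exists phi : formula L (I + {e : set_type A & 'I_(projT1 (val e))}),
    X = [set x | exists c : {e : set_type A & 'I_(projT1 (val e))} -> T,
      (forall e : set_type A, projT2 (val e) (fun j => c (existT _ e j))) /\
      sat S phi (tcat x c)].

Definition definable (I : finType) (X : set (I -> T)) : Prop :=
  definable_over (reals setT) X.

Definition imaginary (e : eqclass T) : Prop :=
  exists E : ('I_(projT1 e) -> T) -> ('I_(projT1 e) -> T) -> Prop,
    [/\ definable_over set0 (joint [set p | E p.1 p.2]),
        RelationClasses.Equivalence E &
        exists c, projT2 e = E c].

Definition acl (A : set (eqclass T)) (b : T) : Prop :=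
  exists X : set (unit -> T),
    [/\ definable_over A X, finite_set X & X (fun=> b)].

Definition exchange : Prop :=
  forall (A : set T) (a b : T),
    acl (reals (a |` A)) b -> ~ acl (reals A) b -> acl (reals (b |` A)) a.

Definition adjoin (A : set (eqclass T)) (I : finType) (x : I -> T) :
    set (eqclass T) :=
  A `|` reals (range x).

Definition acl_independent (A : set (eqclass T)) (I : finType) (a : I -> T)
    (J : {set I}) : Prop :=
  forall i, i \in J ->
    ~ acl (A `|` reals [set a j | j in [set j | j \in J /\ j <> i]]) (a i).

Definition dim (A : set (eqclass T)) (I : finType) (a : I -> T) : nat :=
  \max_(J : {set I} | `[< acl_independent A a J >]) #|J|.

(* The maximum of dim(x/A) for x in X, which is at most #|I|. *)
Definition dim_set (A : set (eqclass T)) (I : finType) (X : set (I -> T)) : nat :=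
  \max_(d < #|I|.+1 | `[< exists2 x, X x & dim A x = d >]) d.

Definition generic (A : set (eqclass T)) (I : finType) (X : set (I -> T))
    (a : I -> T) : Prop :=
  X a /\ dim A a = dim_set A X.

Definition independent (A : set (eqclass T)) (I J : finType)
    (a : I -> T) (b : J -> T) : Prop :=
  dim A (tcat a b) = (dim A a + dim A b)%N.

(* Every finitely satisfiable 1-type over a countable set is realized. *)
Definition aleph1_saturated : Prop :=
  forall (A : set T) (F : set (set (unit -> T))),
    countable A ->
    (forall X, F X -> definable_over (reals A) X) ->
    (forall G, G `<=` F -> finite_set G -> \bigcap_(X in G) X !=set0) ->
    \bigcap_(X in F) X !=set0.

End Definability.

(* Exchange and elimination of "there are infinitely many", in all models of the
   complete theory of S. *)
Definition geometric (L : language) (T : Type) (S : structure L T) : Prop :=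
  (forall (N : Type) (SN : structure L N),
     elementarily_equivalent S SN -> exchange SN) /\
  (forall (J : finType) (phi : formula L (option J)),
     exists psi : formula L J,
       forall (N : Type) (SN : structure L N), elementarily_equivalent S SN ->
         forall b : J -> N,
           sat SN psi b <-> infinite_set [set x : N | sat SN phi (oapp b x)]).

Section MorleyRank.
Variable L : language.

Definition strongly_minimal (T : Type) (S : structure L T) : Prop :=
  forall (N : Type) (SN : structure L N) (h : T -> N), elementary S SN h ->
    forall X : set (unit -> N), definable SN X -> finite_set X \/ finite_set (~` X).

(* An L(T)-formula in the variables I is a formula with free variables in I + T,
   each element of T naming itself. *)
Definition realizations (T : Type) (S : structure L T) (I : finType)
    (phi : formula L (I + T)) : set (I -> T) :=
  [set x | sat S phi (tcat x id)].

Definition realizations_in (T N : Type) (SN : structure L N) (h : T -> N)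
    (I : finType) (phi : formula L (I + T)) : set (I -> N) :=
  [set x | sat SN phi (tcat x h)].

(* RM(phi) >= n, the disjoint families of subsets being taken in arbitrary
   elementary extensions (equivalently, in the monster model). *)
Fixpoint formula_rank_ge (I : finType) (n : nat) :
    forall (T : Type) (S : structure L T), formula L (I + T) -> Prop :=
  match n with
  | 0 => fun T S phi => realizations S phi !=set0
  | n'.+1 => fun T S phi =>
      exists (N : Type) (SN : structure L N) (h : T -> N),
        elementary S SN h /\
        exists psi : nat -> formula L (I + N),
          [/\ forall i, realizations SN (psi i) `<=` realizations_in SN h phi,
              forall i j, i <> j ->
                realizations SN (psi i) `&` realizations SN (psi j) = set0 &
              forall i, formula_rank_ge n' SN (psi i)]
  end.

Variables (T : Type) (S : structure L T).

Definition rank_ge (I : finType) (X : set (I -> T)) (n : nat) : Prop :=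
  exists2 phi : formula L (I + T), X = realizations S phi & formula_rank_ge n S phi.

Definition rank (I : finType) (X : set (I -> T)) (r : nat) : Prop :=
  rank_ge X r /\ ~ rank_ge X r.+1.

(* rk(a/A) = r *)
Definition tuple_rank (A : set (eqclass T)) (I : finType) (a : I -> T) (r : nat) :
    Prop :=
  (exists X, [/\ definable_over S A X, X a & rank X r]) /\
  (forall X, definable_over S A X -> X a -> rank_ge X r).

Definition rank_independent (A : set (eqclass T)) (I J : finType)
    (a : I -> T) (b : J -> T) : Prop :=
  exists r s : nat,
    [/\ tuple_rank A a r, tuple_rank A b s & tuple_rank A (tcat a b) (r + s)%N].

End MorleyRank.

(* {X_t : t in T}, with T = base and X_t = member t (relevant for t in T only). *)
Record set_family (T : Type) (I J : finType) := Family {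
  base : set (J -> T);
  member :> (J -> T) -> set (I -> T) }.

Definition graph (T : Type) (I J : finType) (F : set_family T I J) :
    set (I + J -> T) :=
  joint [set p | base F p.2 /\ F p.2 p.1].

Definition indices_at (T : Type) (I J : finType) (F : set_family T I J)
    (x : I -> T) : set (J -> T) :=
  [set t | base F t /\ F t x].

Section Families.
Variables (L : language) (T : Type) (S : structure L T).

Definition definable_family (A : set (eqclass T)) (I J : finType)
    (F : set_family T I J) : Prop :=
  definable_over S A (base F) /\ definable_over S A (graph F).

Definition almost_faithful (I J : finType) (F : set_family T I J) : Prop :=
  exists d : nat,
    (forall t, base F t -> rank S (F t) d) /\
    (forall t, base F t ->
       finite_set [set t' | base F t' /\ rank S (F t `&` F t') d]).

Definition plane_curve (C : set ('I_2 -> T)) : Prop :=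
  definable S C /\ rank S C 1.

Definition nontrivial_plane_curve (C : set ('I_2 -> T)) : Prop :=
  plane_curve C /\
  forall (i : 'I_2) (a : T), finite_set [set x | C x /\ x i = a].

Definition family_of_plane_curves (J : finType) (C : set_family T 'I_2 J) : Prop :=
  forall t, base C t -> plane_curve (C t).

Definition not_locally_modular : Prop :=
  exists (J : finType) (C : set_family T 'I_2 J),
    [/\ definable_family (reals setT) C, family_of_plane_curves C,
        almost_faithful C & rank S (base C) 2].

Definition excellent_family (A : set (eqclass T)) (C : set_family T 'I_2 'I_2) :
    Prop :=
  [/\ definable_family A C, almost_faithful C, rank S (base C) 2,
      forall t, base C t -> nontrivial_plane_curve (C t) &
      forall p, indices_at C p = set0 \/ nontrivial_plane_curve (indices_at C p)].

(* [~ rank_ge S X r] means rk(X) <= r - 1, the empty set included. *)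
Definition standard_family (A : set (eqclass T)) (r : nat)
    (C : set_family T 'I_2 'I_r) : Prop :=
  [/\ definable_family A C, family_of_plane_curves C, almost_faithful C,
      (1 <= r)%N /\ rank S (base C) r &
      forall x, ~ rank_ge S (indices_at C x) r].

End Families.

Section HausdorffGeometric.
Variables (L : language) (K : topologicalType) (S : structure L K).

(* With U, V relatively open neighborhoods of x in X and y in Y, f and g are
   mutually inverse homeomorphisms and Z restricted to U x V is the graph of f. *)
Definition local_homeomorphism_at (I J : finType)
    (X : set {ptws I -> K}) (Y : set {ptws J -> K})
    (Z : set ({ptws I -> K} * {ptws J -> K}))
    (x : {ptws I -> K}) (y : {ptws J -> K}) : Prop :=
  exists (O : set {ptws I -> K}) (O' : set {ptws J -> K})
         (f : {ptws I -> K} -> {ptws J -> K}) (g : {ptws J -> K} -> {ptws I -> K}),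
    let U := X `&` O in let V := Y `&` O' in
    [/\ open O /\ open O', U x /\ V y,
        {within U, continuous f} /\ {within V, continuous g},
        (forall u, U u -> V (f u) /\ g (f u) = u) /\
        (forall v, V v -> U (g v) /\ f (g v) = v) &
        forall u v, (Z (u, v) /\ U u /\ V v) <-> (U u /\ v = f u)].

Record hausdorff_geometric : Prop := HausdorffGeometric {
  hg_hausdorff : hausdorff_space K;
  hg_geometric : geometric S;
  hg_saturated : aleph1_saturated S;
  hg_frontier : forall (A : set K) (I : finType) (X : set {ptws I -> K})
      (a : {ptws I -> K}),
    countable A -> definable_over S (reals A) X ->
    closure (closure X `\` X) a ->
    (dim S (reals A) a < dim_set S (reals A) X)%N;
  hg_generic : forall (A B : set K) (I : finType) (X : set {ptws I -> K})
      (a : {ptws I -> K}),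
    countable A -> countable B -> A `<=` B -> definable_over S (reals A) X ->
    generic S (reals A) X a ->
    forall W, nbhs a W -> exists2 b, W b & generic S (reals B) X b;
  hg_homeo : forall (A : set K) (I J : finType)
      (X : set {ptws I -> K}) (Y : set {ptws J -> K})
      (Z : set ({ptws I -> K} * {ptws J -> K}))
      (x : {ptws I -> K}) (y : {ptws J -> K}),
    countable A ->
    definable_over S (reals A) X -> definable_over S (reals A) Y ->
    definable_over S (reals A) (joint Z) ->
    Z `<=` X `*` Y ->
    dim_set S (reals A) X = dim_set S (reals A) Y ->
    dim_set S (reals A) X = dim_set S (reals A) (joint Z) ->
    (forall u, finite_set [set v | Z (u, v)]) ->
    (forall v, finite_set [set u | Z (u, v)]) ->
    generic S (reals A) (joint Z) (tcat x y) -> Z (x, y) ->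
    local_homeomorphism_at X Y Z x y }.

End HausdorffGeometric.

Definition ramification_point (P Q : topologicalType) (D : set P) (f : P -> Q)
    (x0 : P) : Prop :=
  D x0 /\
  closure [set p : P * P | [/\ D p.1, D p.2, p.1 <> p.2 & f p.1 = f p.2]] (x0, x0).

Section Intersections.
Variables (L : language) (K : topologicalType) (S : structure L K).
Variables (I J J' : finType) (A : set (eqclass K)).
Variables (X : set (I -> K)) (Y : set_family K I J) (Z : set_family K I J').

Definition weakly_generic_intersection
    (q : {ptws I -> K} * {ptws J -> K} * {ptws J' -> K}) : Prop :=
  let: (x, t, u) := q in
  [/\ generic S A X x, generic S A (base Y) t, generic S A (base Z) u,
      generic S A (graph Y) (tcat x t) & generic S A (graph Z) (tcat x u)].

Definition strongly_generic_intersection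
    (q : {ptws I -> K} * {ptws J -> K} * {ptws J' -> K}) : Prop :=
  let: (x, t, u) := q in
  [/\ weakly_generic_intersection q, independent S A t u &
      independent S (adjoin A x) t u].

Definition strongly_approximable
    (q : {ptws I -> K} * {ptws J -> K} * {ptws J' -> K}) : Prop :=
  forall W, nbhs q W -> exists2 q', W q' & strongly_generic_intersection q'.

Definition intersections : set ({ptws I -> K} * {ptws J -> K} * {ptws J' -> K}) :=
  [set q | graph Y (tcat q.1.1 q.1.2) /\ graph Z (tcat q.1.1 q.2)].

Definition generic_multiple_intersection
    (q : {ptws I -> K} * {ptws J -> K} * {ptws J' -> K}) : Prop :=
  weakly_generic_intersection q /\
  ramification_point intersections (fun q' => (q'.1.2, q'.2)) q.

(* The subtraction does not truncate, by subadditivity of dim. *)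
Definition codim (q : {ptws I -> K} * {ptws J -> K} * {ptws J' -> K}) : nat :=
  let: (x, t, u) := q in
  (dim S (adjoin A x) t + dim S (adjoin A x) u - dim S (adjoin A x) (tcat t u))%N.

End Intersections.

Definition ramification_purity (L : language) (K : topologicalType)
    (S : structure L K) : Prop :=
  forall (A : set K) (I J J' : finType) (X : set (I -> K))
         (Y : set_family K I J) (Z : set_family K I J'),
    countable A ->
    definable_over S (reals A) X ->
    definable_family S (reals A) Y -> definable_family S (reals A) Z ->
    (forall t, base Y t -> Y t `<=` X) -> (forall u, base Z u -> Z u `<=` X) ->
    (exists2 q, generic_multiple_intersection S (reals A) X Y Z q
              & strongly_approximable S (reals A) X Y Z q) ->
    exists2 q, generic_multiple_intersection S (reals A) X Y Z q
             & (codim S (reals A) q <= 1)%N.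

Section Relics.
Variables (K : Type) (n : nat) (M : set ('I_n -> K)).

Definition flat (J : Type) (a : J -> set_type M) : J * 'I_n -> K :=
  fun p => val (a p.1) p.2.

(* The element of K^eq given by an element of M^eq, the index set 'I_k * 'I_n
   being enumerated. *)
Definition flat_eqclass (e : eqclass (set_type M)) : eqclass K :=
  existT (fun k => set ('I_k -> K)) #|{: 'I_(projT1 e) * 'I_n}|
    [set flat a \o enum_val | a in projT2 e].

Definition flat_family (I J : finType) (F : set_family (set_type M) I J) :
    set_family K (I * 'I_n)%type (J * 'I_n)%type :=
  Family (@flat J @` base F)
    (fun s => [set y | exists t x, [/\ s = flat t, y = flat x & F t x]]).

Variables (L : language) (S : structure L K).
Variables (LM : language) (SM : structure LM (set_type M)).

(* A subset of a power of K is interpretable in K iff it is definable. *)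
Definition definable_relic : Prop :=
  definable S M /\
  forall (J : finType) (D : set (J -> set_type M)),
    definable SM D -> definable S (@flat J @` D).

Definition zero_definable_sets_are_zero_definable : Prop :=
  forall (J : finType) (D : set (J -> set_type M)),
    definable_over SM set0 D -> definable_over S set0 (@flat J @` D).

End Relics.

Definition detects_multiple_intersections (L : language) (K : topologicalType)
    (S : structure L K) (n : nat) (M : set ('I_n -> K))
    (LM : language) (SM : structure LM (set_type M)) : Prop :=
  forall (A : set (eqclass (set_type M))) (r r' : nat)
         (C : set_family (set_type M) 'I_2 'I_r)
         (D : set_family (set_type M) 'I_2 'I_r')
         (x : 'I_2 -> set_type M) (t : 'I_r -> set_type M) (u : 'I_r' -> set_type M),
    countable A -> A `<=` imaginary SM ->
    standard_family SM A C -> standard_family SM A D ->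
    generic_multiple_intersection S (@flat_eqclass K n M @` A)
      (range (@flat K n M 'I_2)) (flat_family C) (flat_family D)
      (flat x, flat t, flat u) ->
    ~ rank_independent SM A t u.

(* Main.v *)
(* Let d = dim M, so that M-definable sets of rank r have K-dimension rd, and let
   {C_t : t in T} be an excellent family.  For t generic in T and x generic in C_t
   over t, the triple (x, t, t) is a generic multiple intersection of the family
   with itself, because every point of C_t near x also lies on both curves; moving
   the second t inside {u : x in C_u} makes it strongly approximable.  Purity then
   gives a generic multiple intersection (x, t, u) of codimension at most 1, that
   is, dim(xtu) >= 4d - 1.  But t and u are M-dependent, so dim(tu) <= 3d.  If C_t
   and C_u meet in a finite set then x is algebraic over tu; otherwise u is
   algebraic over t by almost faithfulness.  In both cases dim(xtu) <= 3d, whence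
   d <= 1.

   Morley rank is compared with dim through "full" sets: X is full along
   coordinates i_1, ..., i_k if infinitely many a_1 have infinitely many a_2 ...
   such that some x in X has x_{i_j} = a_j for all j.  In M, rank >= k means full
   along some k coordinates; in K, full along l means that X has points whose
   l-coordinates are acl-independent over any given countable set. *)
Require Import Defs.
From mathcomp Require Import all_boot.
From mathcomp Require Import all_classical.
From mathcomp Require Import topology.

Set Implicit Arguments.
Unset Strict Implicit.
Unset Printing Implicit Defensive.

Local Open Scope classical_set_scope.

(** * First-order formulas *)

(** Morley rank is computed in elementary extensions of [SM], which have no relation to K, while
    dimension exists in K only. Fullness bridges the two: along a fixed list it is a first-order
    condition, uniformly in all elementary extensions, once the quantifier for infinitely many
    values is. A full set found in an extension is therefore already full in M, where saturation of
    K realizes it. For M this uniformity also comes from saturation of K: if the finite fibres of a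
    formula were unbounded, M itself would contain a definable set that is infinite and coinfinite.
    Strong approximability asks for t and u to be independent over the empty set as well, although u
    is chosen generic only over x and t. This is automatic: the choice gives dim(xtu) = 4d, and u is
    not algebraic over t, so x is algebraic over tu and dim(tu) = 4d. *)

Arguments Falsum {L V}.
Arguments Var {L V}.

Section Formulas.
Variable L : language.

Fixpoint term_rename (V W : Type) (s : V -> W) (t : term L V) : term L W :=
  match t with
  | Var i => Var (s i)
  | App f ts => App (fun j => term_rename s (ts j))
  end.

Fixpoint rename (V W : Type) (s : V -> W) (phi : formula L V) : formula L W :=
  match phi with
  | Falsum => Falsum
  | Equal t u => Equal (term_rename s t) (term_rename s u)
  | Atom r ts => Atom (fun j => term_rename s (ts j))
  | Imp p q => Imp (rename s p) (rename s q)
  | All p => All (rename (omap s) p)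
  end.

Definition Neg V (p : formula L V) := Imp p Falsum.
Definition And V (p q : formula L V) := Neg (Imp p (Neg q)).
Definition Ex V (p : formula L (option V)) := Neg (All (Neg p)).
Definition Eqv V (i j : V) : formula L V := Equal (Var i) (Var j).

Lemma oapp_omap (V W T : Type) (s : V -> W) (v : W -> T) x :
  oapp v x \o omap s = oapp (v \o s) x.
Proof. by apply: funext => -[]. Qed.

Lemma oapp_eq (V T : Type) (x : T) (w : option V -> T) (v : V -> T) :
  w None = x -> (forall i, w (Some i) = v i) -> w = oapp v x.
Proof. by move=> h0 h1; apply: funext => -[]. Qed.

Lemma tcat_eq (I J T : Type) (w : I + J -> T) (x : I -> T) (y : J -> T) :
  (forall i, w (inl i) = x i) -> (forall j, w (inr j) = y j) -> w = tcat x y.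
Proof. by move=> h0 h1; apply: funext => -[]. Qed.

Section Sat.
Variables (T : Type) (S : structure L T).

Lemma eval_rename V W (s : V -> W) t (v : W -> T) :
  Defs.eval S v (term_rename s t) = Defs.eval S (v \o s) t.
Proof. by elim: t => //= f ts IH; congr interp_fun; apply: funext => j. Qed.

Lemma sat_rename V W (s : V -> W) phi (v : W -> T) :
  sat S (rename s phi) v <-> sat S phi (v \o s).
Proof.
elim: phi W s v => {V} [V|V t u|V r ts|V p IHp q IHq|V p IHp] W s v //=.
- by rewrite !eval_rename.
- suff -> : (fun j => Defs.eval S v (term_rename s (ts j))) =
    (fun j => Defs.eval S (v \o s) (ts j)) by [].
  by apply: funext => j; rewrite eval_rename.
- by rewrite (propext (IHp _ _ _)) (propext (IHq _ _ _)).
- split=> h x; move: (h x).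
  + by move/IHp; rewrite oapp_omap.
  + by move=> h'; apply/IHp; rewrite oapp_omap.
Qed.

Lemma sat_And V (p q : formula L V) v : sat S (And p q) v <-> sat S p v /\ sat S q v.
Proof. by rewrite /=; split=> [/not_implyP[? /contrapT]|[? ?]]; [split|exact]. Qed.

Lemma sat_Ex V (p : formula L (option V)) v :
  sat S (Ex p) v <-> exists x, sat S p (oapp v x).
Proof.
split=> [/= h|[x hx] /= h]; last exact: (h x).
by apply: contrapT => hn; apply: h => x hx; apply: hn; exists x.
Qed.

End Sat.

(** Deleting the chosen element at each step stands for the pairwise inequalities, so that the
    formula [AtLeast] can follow the same recursion. *)
Fixpoint at_least (T : Type) (m : nat) (A : set T) : Prop :=
  match m with
  | 0 => True
  | m'.+1 => exists2 a, A a & at_least m' (A `\ a)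
  end.

Fixpoint AtLeast (m : nat) (V : Type) (p : formula L (option V)) : formula L V :=
  match m with
  | 0 => Neg Falsum
  | m'.+1 => Ex (And p (AtLeast m'
      (And (rename (omap Some) p) (Neg (Eqv None (Some None))))))
  end.

Lemma sat_AtLeast T (S : structure L T) m V (p : formula L (option V)) v :
  sat S (AtLeast m p) v <-> at_least m [set x | sat S p (oapp v x)].
Proof.
elim: m V p v => [|m IH] V p v; first by split=> // _ [].
rewrite [AtLeast _ _]/= sat_Ex /=.
have E a : sat S (AtLeast m
      (And (rename (omap Some) p) (Neg (Eqv None (Some None))))) (oapp v a) <->
   at_least m ([set x | sat S p (oapp v x)] `\ a).
  rewrite IH; set X := (X in at_least m X); suff -> : X = [set x | sat S p (oapp v x)] `\ a by [].
  apply/seteqP; split=> x; rewrite /X /mkset sat_And sat_rename.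
    by rewrite oapp_omap => -[].
  by rewrite oapp_omap => -[].
split=> [[a /sat_And[h1 /E h2]]|[a h1 /E h2]]; first by exists a.
by exists a; apply/sat_And.
Qed.

Lemma Ex_ordinal_tuple k V (p : formula L ('I_k + V)) :
  exists q : formula L V, forall T (S : structure L T) v,
    sat S q v <-> exists x : 'I_k -> T, sat S p (tcat x v).
Proof.
elim: k V p => [|k IH] V p.
  exists (rename (fun i : 'I_0 + V => match i with inl i => False_rect _ (notF (ltn_ord i))
           | inr v => v end) p) => T S v.
  rewrite sat_rename; set w := v \o _.
  have wE x : w = tcat x v by apply: tcat_eq => // -[].
  split=> [h|[x]]; last by rewrite -wE.
  have x : 'I_0 -> T by case.
  by exists x; rewrite -wE.
(* Coordinate 0 becomes [None], the variable bound by [Ex], and the others are shifted down. *)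
pose s (i : 'I_k.+1 + V) : 'I_k + option V := match i with
  | inl i => if unlift ord0 i is Some j then inl j else inr None
  | inr v => inr (Some v) end.
have [q qP] := IH _ (rename s p).
exists (Ex q) => T S v; rewrite sat_Ex; split=> [[a /qP[x]]|[x hx]].
  rewrite sat_rename; set w := tcat _ _ \o _.
  move=> h; exists (w \o inl).
  by suff <- : w = tcat (w \o inl) v by []; apply: tcat_eq.
exists (x ord0); apply/qP; exists (x \o lift ord0); apply/sat_rename.
set w := tcat _ _ \o _; suff -> : w = tcat x v by [].
apply: tcat_eq => // i; rewrite /w /s /=.
by case: unliftP => [j ->|->].
Qed.

Lemma Ex_tuple (I : finType) V (p : formula L (I + V)) :
  exists q : formula L V, forall T (S : structure L T) v,
    sat S q v <-> exists x : I -> T, sat S p (tcat x v).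
Proof.
pose s (i : I + V) : 'I_#|I| + V := match i with inl i => inl (enum_rank i)
  | inr v => inr v end.
have [q qP] := Ex_ordinal_tuple (rename s p); exists q => T S v.
rewrite qP; split=> -[x].
  rewrite sat_rename => hx; exists (x \o enum_rank).
  by suff <- : tcat x v \o s = tcat (x \o enum_rank) v by []; apply: tcat_eq.
move=> hx; exists (x \o enum_val); apply/sat_rename.
suff -> : tcat (x \o enum_val) v \o s = tcat x v by [].
by apply: tcat_eq => //= i; rewrite enum_rankK.
Qed.

Lemma term_support V (t : term L V) :
  exists (J : finType) (s : J -> V) (t0 : term L J), term_rename s t0 = t.
Proof.
elim: t => [i|f ts IH].
  by exists unit, (fun=> i), (Var tt).
have [J hJ] := fin_all_exists IH.
have [s hs] := fin_all_exists hJ.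
have [t ht] := fin_all_exists hs.
exists {j : 'I_(fun_arity f) & J j}, (fun p => s (tag p) (tagged p)).
exists (App (fun j => term_rename (fun x => Tagged J x) (t j))) => /=.
congr App; apply: funext => j; rewrite -[RHS]ht.
elim: (t j) => //= g us IHu; congr App; exact: funext.
Qed.

Lemma term_renameA V W X (s : V -> W) (s' : W -> X) t :
  term_rename s' (term_rename s t) = term_rename (s' \o s) t.
Proof. by elim: t => //= g us IHu; congr App; exact: funext. Qed.

Lemma omapA V W X (s : V -> W) (s' : W -> X) : omap s' \o omap s = omap (s' \o s).
Proof. by apply: funext => -[]. Qed.

Lemma renameA V W X (s : V -> W) (s' : W -> X) p :
  rename s' (rename s p) = rename (s' \o s) p.
Proof.
elim: p W X s s' => {V} [V|V t u|V r ts|V p IHp q IHq|V p IHp] W X s s' //=.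
- by rewrite !term_renameA.
- by congr Atom; apply: funext => j; rewrite term_renameA.
- by rewrite IHp IHq.
- by rewrite IHp omapA.
Qed.

(** Below a quantifier [s] may send several variables, or none, to the bound one; those sent to
    [Some] are kept and [None] is added once. *)
Lemma option_support V (J : finType) (s : J -> option V) (p : formula L J) :
  exists (J' : finType) (s' : J' -> V) (p' : formula L (option J')),
    rename (omap s') p' = rename s p.
Proof.
pose J' := {j : J | isSome (s j)}.
have sP (j : J') : exists v, s (val j) = Some v.
  by case: j => j /=; case: (s j) => // v _; exists v.
have [s' hs'] := choice sP.
pose g (j : J) : option J' := insub j.
exists J', s', (rename g p); rewrite renameA; congr rename.
apply: funext => j /=; rewrite /g; case: insubP => [u _ <-|] /=.
  by rewrite hs'.
by case: (s j).
Qed.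

(** Variable types are arbitrary here, whereas [geometric] and definability speak of finite index
    types; a formula mentions finitely many variables. *)
Lemma formula_support V (p : formula L V) :
  exists (J : finType) (s : J -> V) (p0 : formula L J), rename s p0 = p.
Proof.
elim: p => {V} [V|V t u|V r ts|V p [J [s [p' <-]]] q [J' [s' [q' <-]]]|V p [J [s [p' <-]]]].
- by exists void, (of_void V), Falsum.
- have [J [s [t0 <-]]] := term_support t; have [J' [s' [u0 <-]]] := term_support u.
  exists (J + J')%type, (tcat s s').
  by exists (Equal (term_rename inl t0) (term_rename inr u0)); rewrite /= !term_renameA.
- have [J hJ] := fin_all_exists (fun j => term_support (ts j)).
  have [s hs] := fin_all_exists hJ; have [t ht] := fin_all_exists hs.
  exists {j : 'I_(rel_arity r) & J j}, (fun p => s (tag p) (tagged p)).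
  exists (Atom (fun j => term_rename (fun x => Tagged J x) (t j))) => /=.
  by congr Atom; apply: funext => j; rewrite -[RHS]ht term_renameA.
- exists (J + J')%type, (tcat s s'), (Imp (rename inl p') (rename inr q')).
  by rewrite /= !renameA.
- have [J' [s' [q <-]]] := option_support s p'.
  by exists J', s', (All q).
Qed.

Lemma formula_support_option V (p : formula L (option V)) :
  exists (J : finType) (s : J -> V) (p0 : formula L (option J)),
    rename (omap s) p0 = p.
Proof.
have [J [s [p0 <-]]] := formula_support p.
exact: option_support.
Qed.

End Formulas.

(** * Counting the elements of a set *)

Section AtLeast.
Variable T : Type.
Implicit Types A : set T.

Lemma at_least_sub m A B : A `<=` B -> at_least m A -> at_least m B.
Proof.
elim: m A B => //= m IH A B AB [a Aa h]; exists a; first exact: AB.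
by apply: IH h => x [Ax xa]; split => //; apply: AB.
Qed.

Lemma at_leastW m A : at_least m.+1 A -> at_least m A.
Proof. by move=> [a Aa]; apply: at_least_sub => x []. Qed.

Lemma at_least_le m n A : (m <= n)%N -> at_least n A -> at_least m A.
Proof.
move=> /subnK <-; elim: (n - m)%N => // k IH h; apply: IH; exact: at_leastW h.
Qed.

Lemma at_leastD1 m A x : at_least m.+1 A -> at_least m (A `\ x).
Proof.
elim: m A => // m IH A [a Aa h].
have [->//|ax] := EM (x = a).
exists a; first by split => // /esym.
apply: at_least_sub (IH _ h) => y [[? ?] ?]; by repeat split.
Qed.

Lemma infinite_at_least m A : infinite_set A -> at_least m A.
Proof.
elim: m A => //= m IH A iA.
have [a Aa] : A !=set0.
  by apply/set0P/eqP => A0; apply: iA; rewrite A0; apply: finite_set0.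
exists a => //; apply: IH => fA; apply: iA.
apply: (@sub_finite_set _ _ ([set a] `|` A `\ a)).
  by move=> x Ax; have [->|] := EM (x = a); [left|right; split].
by rewrite finite_setU; split => //; exact: finite_set1.
Qed.

Lemma at_least_infinite A : (forall m, at_least m A) -> infinite_set A.
Proof.
move=> h fA.
have [s sA] : exists s : seq {classic T}, A `<=` [set` s].
  have /finite_seqP[s As] : finite_set (A : set {classic T}) by [].
  by exists s; rewrite As.
move: (h (size s).+1) => {h fA}.
elim: s A sA => [|x s IH] A sA; first by case=> a /sA.
move=> /at_leastD1 - /(_ x); apply: IH => y [Ay yx].
by move: (sA _ Ay); rewrite /= inE => /orP[/eqP|].
Qed.

Lemma not_at_leastP m A : ~ at_least m.+1 A ->
  exists2 s : seq {classic T}, (size s <= m)%N & A `<=` [set` s].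
Proof.
elim: m A => [|m IH] A h.
  exists [::] => // a Aa; case: h => /=; by exists a.
have [[a Aa]|A0] := EM (A !=set0); last first.
  by exists [::] => // a Aa; case: A0; exists a.
have /IH[s ss sA] : ~ at_least m.+1 (A `\ a) by move=> h'; apply: h; exists a.
exists (a :: s : seq {classic T}) => // x Ax; rewrite /= inE.
have [->|xa] := EM (x = a); first by rewrite eqxx.
by rewrite (sA x) ?orbT.
Qed.

Lemma not_at_least_finite m A : ~ at_least m A -> finite_set A.
Proof. by move=> h; apply: contrapT => i; apply: h; exact: infinite_at_least. Qed.

End AtLeast.

(** * Definability and algebraic closure over real parameters *)

Section Definable.
Variables (L : language) (T : Type) (S : structure L T).

Lemma real_point_eqclassP (e : eqclass T) a (f : 'I_(projT1 e) -> T) :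
  e = real_point a -> (projT2 e f <-> forall j, f j = a).
Proof.
move=> ee; move: f; rewrite ee /= => f; split=> [-> //|h]; exact: funext.
Qed.

(** The class of a real point is a singleton, so the choice of representatives in [definable_over]
    is forced and becomes a valuation [c] in A. An arbitrary type [V] of parameter names permits
    repetitions. *)
Lemma definable_over_realsP (A : set T) (I : finType) (X : set (I -> T)) :
  definable_over S (reals A) X <->
  exists (V : Type) (phi : formula L (I + V)) (c : V -> T),
    (forall v, A (c v)) /\ X = [set x | sat S phi (tcat x c)].
Proof.
split=> [[phi ->]|[V [phi [c [cA ->]]]]].
  have eP (e : set_type (reals A)) : exists a, A a /\ val e = real_point a.
    by case: e => e /= /set_mem[a Aa <-]; exists a.
  have [a aP] := choice eP.
  exists {e : set_type (reals A) & 'I_(projT1 (val e))}, phi, (fun p => a (tag p)).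
  split=> [p|]; first by case: (aP (tag p)).
  apply/seteqP; split=> x /=.
    case=> c [cP]; suff -> : c = (fun p => a (tag p)) by [].
    apply: funext => -[e j] /=; have := cP e.
    by move/(real_point_eqclassP _ (aP e).2).
  move=> h; exists (fun p => a (tag p)); split=> // e.
  exact/(real_point_eqclassP _ (aP e).2).
pose g (v : V) : {e : set_type (reals A) & 'I_(projT1 (val e))} :=
  existT (fun e : set_type (reals A) => 'I_(projT1 (val e)))
    (exist _ (real_point (c v)) (mem_set (ex_intro2 _ _ (c v) (cA v) erefl))) ord0.
pose s (i : I + V) := match i with inl i => inl i | inr v => inr (g v) end.
exists (rename s phi); apply/seteqP; split=> x /=.
  have eP (e : set_type (reals A)) : exists a, val e = real_point a.
    by case: e => e /= /set_mem[a Aa <-]; exists a.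
  have [a aP] := choice eP.
  move=> h; exists (fun p => a (tag p)); split=> [e|].
    exact/(real_point_eqclassP _ (aP e)).
  apply/sat_rename; set w := _ \o _; suff -> : w = tcat x c by [].
  apply: tcat_eq => // v; rewrite /w /=.
  have /= h' := aP (tag (g v)).
  have : projT2 (real_point (c v)) (fun=> a (tag (g v))).
    exact/(@real_point_eqclassP _ (a (tag (g v)))).
  by move/(congr1 (fun f => f ord0)).
case=> d [dP /sat_rename]; set w := _ \o _; suff -> : w = tcat x c by [].
apply: tcat_eq => // v; rewrite /w /=.
by have /(congr1 (fun f => f ord0)) := dP (tag (g v)).
Qed.

Lemma reals0 : reals set0 = set0 :> set (eqclass T).
Proof. exact: image_set0. Qed.

Lemma definable_over0P (I : finType) (X : set (I -> T)) :
  definable_over S set0 X <-> exists phi : formula L I, X = [set x | sat S phi x].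
Proof.
rewrite -reals0 definable_over_realsP; split=> [[V [phi [c [cA ->]]]]|[phi ->]].
  exists (rename (fun i : I + V => match i with inl i => i
     | inr v => False_rect _ (cA v) end) phi).
  apply/seteqP; split=> x /=; rewrite sat_rename; set w := _ \o _;
    by suff -> : w = tcat x c by []; apply: tcat_eq => // v; case: (cA v).
exists void, (rename inl phi), (of_void T); split=> [[]|].
by apply/seteqP; split=> x /=; rewrite sat_rename.
Qed.

Lemma definable_over_mono (A B : set T) (I : finType) (X : set (I -> T)) :
  A `<=` B -> definable_over S (reals A) X -> definable_over S (reals B) X.
Proof.
move=> AB /definable_over_realsP[V [phi [c [cA ->]]]].
by apply/definable_over_realsP; exists V, phi, c; split=> // v; apply: AB.
Qed.

Lemma finite_preim_tt (P : set T) :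
  finite_set [set z : unit -> T | P (z tt)] <-> finite_set P.
Proof.
split=> fX.
  apply: sub_finite_set (finite_image (fun z => z tt) fX) => a Pa.
  by exists (fun=> a).
apply: sub_finite_set (finite_image (fun a => fun=> a) fX) => z /= Pz.
by exists (z tt) => //; apply: funext => -[].
Qed.

Lemma acl_realsP (A : set T) (b : T) :
  acl S (reals A) b <->
  exists (V : Type) (phi : formula L (option V)) (c : V -> T),
    [/\ forall v, A (c v), finite_set [set x | sat S phi (oapp c x)] &
        sat S phi (oapp c b)].
Proof.
split=> [[X [/definable_over_realsP[V [phi [c [cA ->]]]] fX Xb]]|].
  pose s (i : unit + V) := if i is inr v then Some v else None.
  have sE x : oapp c x \o s = tcat (fun=> x) c by apply: tcat_eq.
  exists V, (rename s phi), c; split=> //; last by rewrite sat_rename sE.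
  rewrite -finite_preim_tt; apply: sub_finite_set fX => z /=.
  rewrite sat_rename sE; by suff -> : (fun=> z tt) = z by []; apply: funext => -[].
case=> V [phi [c [cA fP Pb]]].
pose s (i : option V) : unit + V := if i is Some v then inr v else inl tt.
have sE z : tcat z c \o s = oapp c (z tt) by apply: oapp_eq.
exists [set z | sat S (rename s phi) (tcat z c)]; split.
- by apply/definable_over_realsP; exists V, (rename s phi), c.
- move/finite_preim_tt: fP => fP.
  by apply: sub_finite_set fP => z /=; rewrite sat_rename sE.
- by rewrite /= sat_rename sE.
Qed.

End Definable.

(** * Full sets *)

Section Fullness.
Variables (I T : Type).

(** The terminal condition is a parameter so that one recursion serves both nonemptiness, in [full],
    and the presence of several points, in [disjoint_full_points]. *)
Fixpoint full_by (Phi : set (I -> T) -> Prop) (l : seq I) (X : set (I -> T)) : Prop :=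
  match l with
  | [::] => Phi X
  | i :: l' => infinite_set [set a | full_by Phi l' (X `&` [set x | x i = a])]
  end.

Definition full := full_by (fun X => X !=set0).

Lemma full_cons i l X :
  full (i :: l) X = infinite_set [set a | full l (X `&` [set x | x i = a])].
Proof. by []. Qed.

Lemma full_sub l X Y : X `<=` Y -> full l X -> full l Y.
Proof.
elim: l X Y => [|i l IH] X Y XY; first by case=> x /XY; exists x.
rewrite !full_cons; apply: contra_not; apply: sub_finite_set => a.
by apply: IH; apply: setSI.
Qed.

Lemma infinite_nonempty (A : set T) : infinite_set A -> A !=set0.
Proof.
by move=> iA; apply/set0P/eqP => A0; apply: iA; rewrite A0; apply: finite_set0.
Qed.

Lemma full_nonempty l X : full l X -> X !=set0.
Proof.
elim: l X => // i l IH X; rewrite full_cons => /infinite_nonempty[a /IH].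
by case=> x [Xx _]; exists x.
Qed.

Lemma infinite_exists_fin (J : finType) (U : Type) (P : J -> set U) :
  infinite_set [set a | exists j, P j a] -> exists j, infinite_set (P j).
Proof.
move=> h; apply: contrapT => hn; apply: h.
apply: (@sub_finite_set _ _ (\bigcup_(j in [set: J]) P j)).
  by move=> a [j ?]; exists j.
apply: bigcup_finite => [|j _]; first exact: finite_finset.
by apply: contrapT => h; apply: hn; exists j.
Qed.

End Fullness.

(** * Definability of fullness *)

Section ElimInf.
Variables (L : language) (T : Type) (S : structure L T).

Lemma elementary_id : elementary S S id.
Proof. by []. Qed.

(** One formula must serve all elementary extensions, since the definition of Morley rank moves
    through them. *)
Definition elim_inf := forall (V : Type) (phi : formula L (option V)),
  exists psi : formula L V,
    forall (N : Type) (SN : structure L N) (h : T -> N), elementary S SN h ->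
    forall v, sat SN psi v <-> infinite_set [set x | sat SN phi (oapp v x)].

Definition slice_renaming (I V : Type) (i : I + V) : I + option V :=
  match i with inl i => inl i | inr v => inr (Some v) end.

(** The prescribed value of coordinate i sits at the variable [None], the one whose values
    [elim_inf] counts. *)
Definition Slice (I V : Type) (i : I) (phi : formula L (I + V)) :
    formula L (I + option V) :=
  And (rename (@slice_renaming I V) phi) (Eqv L (inl i) (inr None)).

Lemma sat_Slice I V N (SN : structure L N) i (phi : formula L (I + V)) v a :
  [set x | sat SN (Slice i phi) (tcat x (oapp v a))] =
  [set x | sat SN phi (tcat x v)] `&` [set x | x i = a].
Proof.
have E x : tcat x (oapp v a) \o @slice_renaming I V = tcat x v by apply: tcat_eq.
by apply/seteqP; split=> x; rewrite /mkset sat_And sat_rename E.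
Qed.

(** Fullness of the slices is, by induction, a formula in their common value, to which the
    quantifier for infinitely many values applies. Hence elementary maps preserve and reflect
    fullness. *)
Lemma full_definable (I : finType) l : elim_inf ->
  forall V (phi : formula L (I + V)), exists psi : formula L V,
    forall (N : Type) (SN : structure L N) (h : T -> N), elementary S SN h ->
    forall v, sat SN psi v <-> full l [set x | sat SN phi (tcat x v)].
Proof.
move=> elimS; elim: l => [|i l IH] V phi.
  by have [psi psiP] := Ex_tuple phi; exists psi => N SN h _ v; apply: psiP.
have [psi0 psi0P] := IH _ (Slice i phi).
have [psi psiP] := elimS _ psi0.
exists psi => N SN h hS v; rewrite (psiP _ _ _ hS) full_cons.
suff -> : [set x | sat SN psi0 (oapp v x)] =
  [set a | full l ([set x | sat SN phi (tcat x v)] `&` [set x | x i = a])] by [].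
by apply/seteqP; split=> a; rewrite /mkset (psi0P _ _ _ hS) sat_Slice.
Qed.

Lemma infinite_nat_injection (U : Type) (P : set U) : infinite_set P ->
  exists2 f : nat -> U, injective f & forall i, P (f i).
Proof.
move=> /infiniteP /card_leP[f].
pose e (i : nat) : set_type [set: nat] := exist _ i (mem_set I).
exists (fun i => val (f (e i))); last by move=> i; apply: set_valP.
move=> i j /val_inj /(@inj _ _ _ f) ee.
by have /(congr1 val) := ee (mem_set I) (mem_set I).
Qed.

(** Slices at distinct values of the first coordinate are disjoint and still full along the rest, so
    they witness the rank inside the structure itself. *)
Lemma full_formula_rank_ge (I : finType) l (phi : formula L (I + T)) :
  full l (realizations S phi) -> formula_rank_ge (size l) S phi.
Proof.
elim: l phi => // i l IH phi; rewrite full_cons => /infinite_nat_injection[f f_inj fP].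
exists T, S, id; split; first exact: elementary_id.
(* The default [a] turns the variable [None] of the slice into the name of a. *)
pose s a (j : I + option T) : I + T := match j with
  | inl j => inl j | inr v => inr (odflt a v) end.
have sE a : realizations S (rename (s a) (Slice i phi)) =
    realizations S phi `&` [set x | x i = a].
  rewrite /realizations -(sat_Slice _ _ _ id); apply/seteqP; split=> x; rewrite /mkset sat_rename;
    set w := _ \o _; by suff -> : w = tcat x (oapp id a) by []; apply: tcat_eq => // -[].
exists (fun k => rename (s (f k)) (Slice i phi)); split=> [k|j k jk|k].
- by rewrite sE => x [].
- by rewrite !sE -subset0 => x [[_ /= xj] [_ xk]]; apply: jk; apply: f_inj; rewrite -xj.
- by apply: IH; rewrite sE; apply: fP.
Qed.

Lemma elementary_comp T1 T2 (S1 : structure L T1) (S2 : structure L T2) h g :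
  elementary S S1 h -> elementary S1 S2 g -> elementary S S2 (g \o h).
Proof. by move=> hE gE V phi v; rewrite hE gE. Qed.

End ElimInf.

(** * Morley rank in strongly minimal structures *)

Section StronglyMinimal.
Variables (L : language) (T : Type) (S : structure L T).

(** Beyond [elim_inf], the explicit bound tells how many disjoint full sets are enough to gain one
    more coordinate. *)
Definition bounded_finite_fibers := forall (V : Type) (phi : formula L (option V)),
  exists m : nat,
    forall (N : Type) (SN : structure L N) (h : T -> N), elementary S SN h ->
    forall v, at_least m [set x | sat SN phi (oapp v x)] ->
      infinite_set [set x | sat SN phi (oapp v x)].

Lemma bounded_elim_inf : bounded_finite_fibers -> elim_inf S.
Proof.
move=> bnd V phi; have [m mP] := bnd _ phi.
exists (AtLeast m phi) => N SN h hS v; rewrite sat_AtLeast.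
by split; [exact: mP hS v|exact: infinite_at_least].
Qed.

Lemma strongly_minimalP : strongly_minimal S ->
  forall (N : Type) (SN : structure L N) (h : T -> N), elementary S SN h ->
  forall V (phi : formula L (option V)) v,
    finite_set [set x | sat SN phi (oapp v x)] \/
    finite_set (~` [set x | sat SN phi (oapp v x)]).
Proof.
move=> sm N SN h hS V phi v; set P := [set x | _].
have := sm _ _ _ hS [set z | P (z tt)]; rewrite finite_preim_tt -(finite_preim_tt (~` P)).
apply; apply/definable_over_realsP.
pose s (i : option V) : unit + V := if i is Some v then inr v else inl tt.
exists V, (rename s phi), v; split=> //.
apply/seteqP; split=> z; rewrite /P /mkset sat_rename;
  by suff -> : tcat z v \o s = oapp v (z tt) by []; apply: oapp_eq.
Qed.

Definition points (I U : Type) m (Y : set (I -> U)) :=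
  exists2 f : 'I_m -> I -> U, injective f & forall j, Y (f j).

(* Finitely many infinite definable subsets of a strongly minimal structure
   meet, so finitely many disjoint full sets have points over a common tuple. *)
Lemma disjoint_full_points (I : finType) l m : elim_inf S -> strongly_minimal S ->
  forall (N : Type) (SN : structure L N) (h : T -> N), elementary S SN h ->
  forall V (phi : 'I_m.+1 -> formula L (I + V)) v X,
    (forall j, [set x | sat SN (phi j) (tcat x v)] `<=` X) ->
    (forall i j, i <> j -> [set x | sat SN (phi i) (tcat x v)] `&`
        [set x | sat SN (phi j) (tcat x v)] = set0) ->
    (forall j, full l [set x | sat SN (phi j) (tcat x v)]) ->
    full_by (points m.+1) l X.
Proof.
move=> elimS sm N SN h hS; elim: l => [|i l IH] V phi v X phiX phi_disj phi_full.
  have [f fP] := fin_all_exists phi_full.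
  exists f => [j k fjk|j]; last exact: phiX.
  apply: contrapT => /phi_disj/seteqP[+ _] => /(_ (f j)); apply.
  by split; [exact: fP|rewrite fjk; exact: fP].
pose A j := [set a | full l ([set x | sat SN (phi j) (tcat x v)] `&` [set x | x i = a])].
have cofA j : finite_set (~` A j).
  have [psi psiP] := full_definable l elimS (Slice i (phi j)).
  have AE : A j = [set a | sat SN psi (oapp v a)].
    by apply/seteqP; split=> a; rewrite /A /mkset (psiP _ _ _ hS) sat_Slice.
  have [fA|] := strongly_minimalP sm hS psi v; last by rewrite -AE.
  by rewrite -AE in fA; case: (phi_full j).
move=> finX; apply: (phi_full ord0).
apply: (@sub_finite_set _ _ ([set a | full_by (points m.+1) l (X `&` [set x | x i = a])]
    `|` \bigcup_(j in [set: 'I_m.+1]) ~` A j)); last first.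
  rewrite finite_setU; split=> //; apply: bigcup_finite => //; exact: finite_finset.
move=> a _; have [hA|/existsNP[j hA]] := EM (forall j, A j a); last first.
  by right; exists j.
left; apply: (IH _ (fun j => Slice i (phi j)) (oapp v a)) => j.
- by rewrite sat_Slice => x [/phiX ? ?].
- move=> k jk; rewrite !sat_Slice setIACA (phi_disj _ _ jk); exact: set0I.
- by rewrite sat_Slice; apply: hA.
Qed.

(** If every coordinate took at most m+1 values on Y, then Y would have at most (m+1)^|I| points:
    each point is coded by the positions of its values in lists. *)
Lemma points_values (I : finType) (U : Type) m (Y : set (I -> U)) :
  points (m.+1 ^ #|I|).+1 Y -> exists i, at_least m.+2 [set a | exists2 x, Y x & x i = a].
Proof.
move=> [f f_inj fY]; apply: contrapT => /forallNP h.
have hs i : exists s : seq {classic U}, (size s <= m.+1)%N /\ forall x, Y x -> (x i : {classic U}) \in s.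
  have [s ss sP] := not_at_leastP (h i).
  by exists s; split=> // x Yx; apply: (sP (x i)); exists x.
have [s sP] := choice hs.
pose g j : {ffun I -> 'I_m.+1} := [ffun i => inord (index (f j i : {classic U}) (s i))].
have g_inj : injective g.
  move=> j k /ffunP gjk; apply: f_inj; apply: funext => i.
  have [ss si] := sP i.
  have := congr1 val (gjk i); rewrite !ffunE /= !inordK;
    try by rewrite (leq_trans _ ss) // index_mem si.
  move/(congr1 (nth (f j i : {classic U}) (s i))).
  by rewrite !nth_index ?si.
have := leq_card g g_inj.
by rewrite card_ord card_ffun card_ord ltnn.
Qed.

Lemma infinite_values (I : finType) (U : Type) (Y : set (I -> U)) :
  infinite_set Y -> exists i, infinite_set [set a | exists2 x, Y x & x i = a].
Proof.
move=> /infinite_nat_injection[f f_inj fY]; apply: contrapT => /forallNP h.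
have hm i : exists m, ~ at_least m [set a | exists2 x, Y x & x i = a].
  by apply/existsNP => h'; apply: (h i); exact: at_least_infinite.
have [m mP] := choice hm.
have [i hi] : exists i, at_least (\max_i m i).+2 [set a | exists2 x, Y x & x i = a].
  apply: points_values; exists (fun j => f j) => // j k /f_inj; exact: val_inj.
by apply: (mP i); apply: at_least_le hi; rewrite !leqW // leq_bigmax.
Qed.

(** Many points over a common tuple force many values of some coordinate, hence infinitely many by
    the uniform bound. That coordinate may vary with the tuple, but at each level one of the
    finitely many choices recurs infinitely often. *)
Lemma full_by_points_rcons (I : finType) l : bounded_finite_fibers ->
  forall V (phi : formula L (I + V)), exists m,
  forall (N : Type) (SN : structure L N) (h : T -> N), elementary S SN h ->
  forall v, full_by (points m.+1) l [set x | sat SN phi (tcat x v)] ->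
    exists i, full (rcons l i) [set x | sat SN phi (tcat x v)].
Proof.
move=> bnd; elim: l => [|i l IH] V phi.
  have hm i : exists m, forall (N : Type) (SN : structure L N) (h : T -> N),
      elementary S SN h -> forall v,
      at_least m [set a | exists2 x, sat SN phi (tcat x v) & x i = a] ->
      full [:: i] [set x | sat SN phi (tcat x v)].
    have [q qP] := Ex_tuple (Slice i phi).
    have [m mP] := bnd _ q; exists m => N SN h hS v.
    have E : [set a | exists2 x, sat SN phi (tcat x v) & x i = a] =
       [set a | sat SN q (oapp v a)].
      apply/seteqP; split=> a; rewrite /mkset qP.
        move=> [x h1 h2]; exists x.
        by have : ([set x | sat SN phi (tcat x v)] `&` [set x | x i = a]) x by []; rewrite -sat_Slice.
      move=> [x] hx; have : [set x | sat SN (Slice i phi) (tcat x (oapp v a))] x by [].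
      by rewrite sat_Slice => -[? ?]; exists x.
    rewrite E => /(mP _ _ _ hS); rewrite -E full_cons; apply: contra_not.
    by apply: sub_finite_set => a [x Yx xi]; exists x.
  have [m mP] := fin_all_exists hm.
  exists ((\max_i m i).+1 ^ #|I|) => N SN h hS v /points_values[i hi].
  exists i; apply: mP hS _ _; apply: at_least_le hi.
  by rewrite !leqW // leq_bigmax.
have [m mP] := IH _ (Slice i phi).
exists m => N SN h hS v /= hl.
suff : infinite_set [set a | exists j, full (rcons l j) ([set x | sat SN phi (tcat x v)] `&` [set x | x i = a])].
  by move/infinite_exists_fin => [j hj]; exists j.
apply: contra_not hl; apply: sub_finite_set => a /=.
by rewrite -sat_Slice => /(mP _ _ _ hS).
Qed.

(** There are finitely many lists of length n, so infinitely many of the disjoint subsets given by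
    the rank are full along the same one. Finitely many of these already have distinct points over
    common tuples, which supplies one more coordinate; definability of fullness brings the result
    back from the extension. *)
Lemma formula_rank_ge_full (I : finType) n : bounded_finite_fibers -> strongly_minimal S ->
  forall (N : Type) (SN : structure L N) (h : T -> N), elementary S SN h ->
  forall phi : formula L (I + N), formula_rank_ge n SN phi ->
    exists2 l : seq I, size l = n & full l (realizations SN phi).
Proof.
move=> bnd sm; have elimS := bounded_elim_inf bnd.
elim: n => [|n IH] N SN h hS phi; first by exists [::].
move=> [N' [SN' [h' [hS' [psi [psi_sub psi_disj psi_rank]]]]]].
have hN' := elementary_comp hS hS'.
have hl k : exists l : n.-tuple I, full l (realizations SN' (psi k)).
  have [l sl fl] := IH _ _ _ hN' _ (psi_rank k).
  by exists (Tuple (introT eqP sl)).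
have [l lP] := choice hl.
have : infinite_set [set k | exists t, l k = t].
  have -> : [set k | exists t, l k = t] = [set: nat].
    by apply/seteqP; split=> // k _; exists (l k).
  exact: infinite_nat.
move=> /infinite_exists_fin[t /infinite_nat_injection[f f_inj fP]].
have [m mP] := full_by_points_rcons t bnd phi.
have [i] : exists i, full (rcons t i) (realizations_in SN' h' phi).
  apply: (mP _ _ _ hN' h').
  apply: (@disjoint_full_points _ _ _ elimS sm _ _ _ hN' _ (fun j => psi (f j)) id).
  - by move=> j; apply: psi_sub.
  - by move=> j k jk; apply: psi_disj => /f_inj/val_inj.
  - by move=> j; rewrite -(fP j); apply: lP.
have [q qP] := full_definable (rcons t i) elimS phi.
move=> /(qP _ _ _ hN' h'); rewrite -[h']/(h' \o id) -hS' => /(qP _ _ _ hS id) hf.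
by exists (rcons t i); rewrite // size_rcons size_tuple.
Qed.

End StronglyMinimal.

(** * Algebraic independence *)

Lemma countableU T (A B : set T) : countable A -> countable B -> countable (A `|` B).
Proof.
move=> cA cB; have -> : A `|` B = \bigcup_(b in [set: bool]) if b then A else B.
  apply/seteqP; split=> x; first by case=> h; [exists true|exists false].
  by case=> -[] _ h; [left|right].
by apply: bigcup_countable => // -[].
Qed.

Section Rank.
Variables (L : language) (T : choiceType) (S : structure L T).
Implicit Types (A B : set T) (s : seq T).

Lemma realsU A B : reals (A `|` B) = reals A `|` reals B.
Proof. exact: image_setU. Qed.

Lemma acl_mono A B b : A `<=` B -> acl S (reals A) b -> acl S (reals B) b.
Proof.
move=> AB [X [dX fX Xb]]; exists X; split=> //; exact: definable_over_mono dX.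
Qed.

Lemma acl_mem A a : A a -> acl S (reals A) a.
Proof.
move=> Aa; apply/acl_realsP; exists unit, (Eqv L None (Some tt)), (fun=> a).
by split=> //=; exact: finite_set1.
Qed.

(** In a formula witnessing y over Ax, x is replaced by a variable u ranging over the finitely many
    solutions of [phi]. Other values of u might have infinite fibres, so a bound m from the fibre
    over x is built into the formula. *)
Lemma acl_trans A x y :
  acl S (reals A) x -> acl S (reals (x |` A)) y -> acl S (reals A) y.
Proof.
move=> /acl_realsP[V [phi [c [cA fphi px]]]] /acl_realsP[W [psi [d [dA fpsi py]]]].
pose W' := {w : W | A (d w)}.
(* Parameters in A are kept; the others equal x and become the variable u. *)
pose s (w : W) : option W' :=
  match pselect (A (d w)) with left h => Some (exist _ w h) | right _ => None end.
pose d' (w : W') := d (sval w).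
have sE : oapp d' x \o s = d.
  apply: funext => w /=; rewrite /s; case: pselect => //= nA.
  by case: (dA w) => // ->.
have [m nm] : exists m, ~ at_least m [set z | sat S psi (oapp d z)].
  by apply/existsNP => h; apply: at_least_infinite fpsi.
pose r1 (i : option V) : option (option (V + W')) := match i with
  | None => None | Some v => Some (Some (inl v)) end.
pose t1 (i : option W) : option (option (V + W')) := match i with
  | None => Some None | Some w => omap (fun w => Some (inr w)) (s w) end.
pose t2 (i : option W) : option (option (option (V + W'))) := match i with
  | None => None | Some w => Some (omap (fun w => Some (inr w)) (s w)) end.
pose theta := Ex (And (rename r1 phi) (And (rename t1 psi) (Neg (AtLeast m (rename t2 psi))))).
have E1 z u : oapp (oapp (tcat c d') z) u \o r1 = oapp c u by apply: oapp_eq.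
have E2 z u : oapp (oapp (tcat c d') z) u \o t1 = oapp (oapp d' u \o s) z.
  by apply: oapp_eq => // i /=; case: (s i).
have E3 z u y' : oapp (oapp (oapp (tcat c d') z) u) y' \o t2 = oapp (oapp d' u \o s) y'.
  by apply: oapp_eq => // i /=; case: (s i).
have thetaP z : sat S theta (oapp (tcat c d') z) <-> exists u,
    [/\ sat S phi (oapp c u), sat S psi (oapp (oapp d' u \o s) z) &
       ~ at_least m [set z | sat S psi (oapp (oapp d' u \o s) z)]].
  have E u : sat S (AtLeast m (rename t2 psi)) (oapp (oapp (tcat c d') z) u) <->
      at_least m [set z | sat S psi (oapp (oapp d' u \o s) z)].
    rewrite sat_AtLeast; set X := (X in at_least m X); set Y := (Y in _ <-> at_least m Y).
    suff -> : X = Y by [].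
    by apply/seteqP; split=> y'; rewrite /X /Y /mkset sat_rename E3.
  rewrite sat_Ex; split=> -[u hu]; exists u; move: hu; rewrite !sat_And !sat_rename E1 E2.
    by move=> [h1 [h2 h3]]; split=> //; apply: contra_not h3 => /E.
  by move=> [h1 h2 h3]; split=> //; split=> //; apply: contra_not h3 => /E.
apply/acl_realsP; exists (V + W')%type, theta, (tcat c d'); split.
- by case=> [v|[w]]; [exact: cA|].
- apply: (@sub_finite_set _ _ (\bigcup_(u in [set u | sat S phi (oapp c u)] `&` [set u |
     ~ at_least m [set z | sat S psi (oapp (oapp d' u \o s) z)]])
     [set z | sat S psi (oapp (oapp d' u \o s) z)])).
    by move=> z /thetaP[u [h1 h2 h3]]; exists u.
  apply: bigcup_finite; first exact: finite_setIl.
  by move=> u [_ /not_at_least_finite].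
- by apply/thetaP; exists x; rewrite sE.
Qed.

Lemma set_seq_cons x s : [set` x :: s] = x |` [set` s].
Proof.
apply/seteqP; split=> y /=; rewrite inE; first by case/orP=> [/eqP ->|ys]; [left|right].
by case=> [->|/= ->]; rewrite ?eqxx ?orbT.
Qed.

(** This order-dependent count makes additivity a matter of concatenation. Exchange then removes the
    dependence on the order, and [dimE] identifies the count with [dim]. *)
Fixpoint acl_rank A s : nat :=
  if s is x :: s' then (~~ `[< acl S (reals A) x >] + acl_rank (x |` A) s')%N else 0%N.

Lemma acl_rank_mono A B s : A `<=` B -> (acl_rank B s <= acl_rank A s)%N.
Proof.
elim: s A B => //= x s IH A B AB; apply: leq_add; last by apply: IH; apply: setUS.
case: asboolP => //= nB; case: asboolP => //= aA; exfalso; apply: nB.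
exact: acl_mono aA.
Qed.

Lemma acl_rank_cat A s s' :
  acl_rank A (s ++ s') = (acl_rank A s + acl_rank (A `|` [set` s]) s')%N.
Proof.
elim: s A => [|x s IH] A /=; first by rewrite (_ : [set` [::]] = set0) ?setU0 //; apply/seteqP; split.
rewrite IH addnA; congr (_ + acl_rank _ _)%N.
by rewrite set_seq_cons (setUC [set x] A) setUA.
Qed.

Lemma acl_rank_rcons A s x :
  acl_rank A (rcons s x) = (acl_rank A s + ~~ `[< acl S (reals (A `|` [set` s])) x >])%N.
Proof. by rewrite -cats1 acl_rank_cat /= addn0. Qed.

Lemma acl_rank_size A s : (acl_rank A s <= size s)%N.
Proof. by elim: s A => //= x s IH A; rewrite -add1n leq_add // leq_b1. Qed.

Lemma acl_rank_eq0 A s : {in s, forall x, acl S (reals A) x} -> acl_rank A s = 0%N.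
Proof.
elim: s A => //= x s IH A h.
have -> : `[< acl S (reals A) x >] by apply/asboolP; apply: h; rewrite inE eqxx.
rewrite IH // => y ys; apply: (@acl_mono A); first exact: subsetUr.
by apply: h; rewrite inE ys orbT.
Qed.

Hypothesis exch : exchange S.

(** The two counts could differ only in patterns that monotonicity, transitivity or exchange
    excludes. *)
Lemma acl_rank_swap A x y s : acl_rank A (x :: y :: s) = acl_rank A (y :: x :: s).
Proof.
rewrite /= setUCA !addnA; congr (_ + _)%N.
have E a b : acl S (reals A) a -> acl S (reals (b |` A)) a.
  by apply: acl_mono; exact: subsetUr.
case: (asboolP (acl S (reals A) x)) => hx; case: (asboolP (acl S (reals A) y)) => hy;
  case: asboolP => hyx; case: asboolP => hxy //=; exfalso;
  first [exact: hxy (E _ _ hx)|exact: hyx (E _ _ hy)|exact: hxy (E _ _ hy)|exact: hyx (E _ _ hx)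
     |exact: hy (acl_trans hx hyx)|exact: hy (acl_trans hx hxy)|exact: hx (acl_trans hy hyx)
     |exact: hx (acl_trans hy hxy)
     |exact: hxy (exch hyx hy)|exact: hyx (exch hxy hx)|exact: hyx (exch hxy hy)|exact: hxy (exch hyx hx)].
Qed.

Lemma acl_rank_catC A s s' : acl_rank A (s ++ s') = acl_rank A (s' ++ s).
Proof.
have mid x u v B : acl_rank B (u ++ x :: v) = acl_rank B (x :: u ++ v).
  by elim: u B => // y u IH B; rewrite acl_rank_swap /= IH.
by elim: s A => [|x s IH] A; rewrite ?cats0 // mid /= IH.
Qed.

Lemma acl_rank_perm A s s' : perm_eq s s' -> acl_rank A s = acl_rank A s'.
Proof.
elim: s A s' => [|x s IH] A s'; first by rewrite perm_sym => /perm_nilP ->.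
move=> pss; have xs' : x \in s' by rewrite -(perm_mem pss) inE eqxx.
case/splitPr: xs' pss => u v pss.
rewrite acl_rank_catC /=; congr (_ + _)%N; rewrite -acl_rank_catC.
by apply: IH; rewrite -(perm_cons x) (perm_trans pss) // perm_catC /= perm_cons perm_catC.
Qed.

Lemma acl_rank_sub A s s' : {subset s <= s'} -> (acl_rank A s <= acl_rank A s')%N.
Proof.
move=> ss'; apply: (@leq_trans (acl_rank A (s' ++ s))).
  by rewrite acl_rank_catC acl_rank_cat leq_addr.
rewrite acl_rank_cat (@acl_rank_eq0 _ s) ?addn0 // => x /ss' xs'.
by apply: acl_mem; right.
Qed.

(** A basis is a list of indices rather than of values, because [full] refers to coordinates. *)
Lemma acl_rank_basis A (I : eqType) (a : I -> T) (s : seq I) : uniq s ->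
  exists l, [/\ size l = acl_rank A [seq a i | i <- s], uniq l,
    acl_rank A [seq a i | i <- l] = size l & {subset l <= s}].
Proof.
elim/last_ind: s => [|s i IH]; first by exists [::].
rewrite rcons_uniq => /andP[is_ /IH[l [h1 h2 h3 h4]]].
rewrite map_rcons acl_rank_rcons; case: asboolP => /= hi.
  exists l; split=> //; first by rewrite addn0.
  by move=> j /h4; rewrite mem_rcons inE orbC => ->.
exists (rcons l i); rewrite size_rcons h1 addn1 map_rcons acl_rank_rcons h3; split=> //.
- by rewrite rcons_uniq h2 andbT; apply: contra is_ => /h4.
- case: asboolP => /= [hi'|]; last by rewrite addn1 h1.
  exfalso; apply: hi; apply: acl_mono hi'; apply: setUS => x /= /mapP[j /h4 js ->].
  exact: map_f.
- by move=> j; rewrite !mem_rcons !inE => /orP[->//|/h4 ->]; rewrite orbT.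
Qed.

Lemma dimE A (I : finType) (a : I -> T) :
  dim S (reals A) a = acl_rank A [seq a i | i <- enum I].
Proof.
apply/eqP; rewrite eqn_leq; apply/andP; split.
  apply/bigmax_leqP => J /asboolP indJ.
  have h (l : seq I) : uniq l -> {subset l <= J} -> acl_rank A [seq a i | i <- l] = size l.
    elim/last_ind: l => // l i IH; rewrite rcons_uniq => /andP[il ul] lJ.
    rewrite map_rcons acl_rank_rcons size_rcons IH //; last first.
      by move=> j jl; apply: lJ; rewrite mem_rcons inE jl orbT.
    case: asboolP => /= [hi|]; last by rewrite addn1.
    exfalso; apply: (indJ i); first by apply: lJ; rewrite mem_rcons inE eqxx.
    rewrite -realsU; apply: acl_mono hi; apply: setUS => x /= /mapP[j jl ->].
    exists j => //; split; first by apply: lJ; rewrite mem_rcons inE jl orbT.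
    by move=> ji; move: il; rewrite -ji jl.
  rewrite cardE -h ?enum_uniq //; last by move=> i; rewrite mem_enum.
  by apply: acl_rank_sub => x /mapP[i _ ->]; apply: map_f; rewrite mem_enum.
have [l [ls ul rl _]] := acl_rank_basis A a (enum_uniq I).
rewrite -ls -(card_uniqP ul).
have -> : #|l| = #|[set i in l]| by apply: eq_card => i; rewrite inE.
apply: leq_bigmax_cond; apply/asboolP => i; rewrite inE => il.
rewrite -realsU => hi.
(* With i moved to the end its entry would contribute 0, leaving a rank below [size l]. *)
have := perm_map a (perm_to_rem il) => /(acl_rank_perm A).
rewrite rl map_cons -cat1s acl_rank_catC cats1 acl_rank_rcons.
case: asboolP => /= hi'; last first.
  move=> _; apply: hi'; apply: acl_mono hi; apply: setUS => x [j [+ ji] <-].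
  rewrite inE => jl; apply: map_f.
  have := perm_mem (perm_to_rem il) j; rewrite jl inE => /esym/orP[/eqP|//].
  by move=> /ji.
move=> h; have := acl_rank_size A [seq a i | i <- rem i l].
rewrite addn0 in h; rewrite -h size_map size_rem //.
by case: (l) il => //= x s _; rewrite ltnn.
Qed.

Lemma dim_setE A (I : finType) (X : set (I -> T)) k :
  (forall x, X x -> (dim S (reals A) x <= k)%N) ->
  (exists2 x, X x & dim S (reals A) x = k) -> dim_set S (reals A) X = k.
Proof.
move=> h [x Xx xk]; apply/eqP; rewrite eqn_leq; apply/andP; split.
  by apply/bigmax_leqP => d /asboolP[y /h + <-].
have kI : (k < #|I|.+1)%N.
  by rewrite ltnS -xk dimE (leq_trans (acl_rank_size _ _)) // size_map cardE.
by apply: (@leq_bigmax_cond _ _ _ (Ordinal kI)); apply/asboolP; exists x.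
Qed.

Lemma dim_le_dim_set A (I : finType) (X : set (I -> T)) x :
  X x -> (dim S (reals A) x <= dim_set S (reals A) X)%N.
Proof.
move=> Xx.
have kI : (dim S (reals A) x < #|I|.+1)%N.
  by rewrite ltnS dimE (leq_trans (acl_rank_size _ _)) // size_map cardE.
by apply: (@leq_bigmax_cond _ _ _ (Ordinal kI)); apply/asboolP; exists x.
Qed.

Lemma dim_set_attained A (I : finType) (X : set (I -> T)) :
  X !=set0 -> exists2 x, X x & dim S (reals A) x = dim_set S (reals A) X.
Proof.
move=> [x Xx].
have kI : (dim S (reals A) x < #|I|.+1)%N.
  by rewrite ltnS dimE (leq_trans (acl_rank_size _ _)) // size_map cardE.
have P0 : `[< exists2 y, X y & dim S (reals A) y = Ordinal kI >].
  by apply/asboolP; exists x.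
rewrite /dim_set; case: (eq_bigmax_cond (fun d : 'I_#|I|.+1 => d : nat) (A := fun d : 'I_#|I|.+1 => `[< exists2 y, X y & dim S (reals A) y = d >])) => [|d /asboolP[y Xy yd] ->].
  by apply/card_gt0P; exists (Ordinal kI).
by exists y.
Qed.

(** If only finitely many values of the first coordinate had full slices, they would form a finite
    set definable over A and containing [a i], against independence. *)
Lemma acl_rank_full (I : finType) (l : seq I) A V (phi : formula L (I + V)) c a :
  elim_inf S -> (forall v, A (c v)) -> sat S phi (tcat a c) ->
  acl_rank A [seq a i | i <- l] = size l -> full l [set x | sat S phi (tcat x c)].
Proof.
move=> elimS; elim: l A V phi c => [|i l IH] A V phi c cA pa /=; first by exists a.
case: asboolP => /= [_ h|nacl [rl]].
  by have := acl_rank_size (a i |` A) [seq a i | i <- l]; rewrite size_map -[acl_rank _ _]/(0 + _)%N h ltnn.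
rewrite full_cons => fin; apply: nacl; apply/acl_realsP.
have [psi psiP] := full_definable l elimS (Slice i phi).
have psiE b : sat S psi (oapp c b) <-> full l ([set x | sat S phi (tcat x c)] `&` [set x | x i = b]).
  by rewrite (psiP _ _ _ (elementary_id S)) sat_Slice.
exists V, psi, c; split=> //.
  by apply: sub_finite_set fin => b /psiE.
apply/(psiP _ _ _ (elementary_id S)); apply: (IH (a i |` A)) => //.
  by case=> [v|]; [right; exact: cA|left].
have : ([set x | sat S phi (tcat x c)] `&` [set x | x i = a i]) a by [].
by rewrite -sat_Slice.
Qed.

(** * Consequences of saturation *)

Hypothesis satS : aleph1_saturated S.

(** The infinite set together with all cofinite [B]-definable sets is finitely satisfiable, and a
    realization avoids every finite [B]-definable set. *)
Lemma infinite_definable_nonalgebraic B V (phi : formula L (option V)) c :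
  countable B -> (forall v, B (c v)) -> infinite_set [set b | sat S phi (oapp c b)] ->
  exists2 b, sat S phi (oapp c b) & ~ acl S (reals B) b.
Proof.
move=> cB cBv inf.
pose P := [set z : unit -> T | sat S phi (oapp c (z tt))].
have dP : definable_over S (reals B) P.
  pose s (i : option V) : unit + V := if i is Some v then inr v else inl tt.
  apply/definable_over_realsP; exists V, (rename s phi), c; split=> //.
  have sE z : tcat z c \o s = oapp c (z tt) by apply: oapp_eq.
  by apply/seteqP; split=> z; rewrite /P /mkset sat_rename sE.
have iP : infinite_set P by rewrite (finite_preim_tt [set b | sat S phi (oapp c b)]).
pose F := P |` [set X | definable_over S (reals B) X /\ finite_set (~` X)].
have [|G GF fG|z zF] := satS cB (F := F).
- by move=> X [->//|[]].
- apply: contrapT => G0; apply: iP.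
  apply: (@sub_finite_set _ _ (\bigcup_(X in G `&` [set X | finite_set (~` X)]) ~` X)); last first.
    by apply: bigcup_finite => [|X []//]; apply: sub_finite_set fG; exact: subIsetl.
  move=> z Pz; apply: contrapT => hz; apply: G0; exists z => X GX.
  have [->//|[dX fX]] := GF _ GX.
  by apply: contrapT => nX; apply: hz; exists X.
exists (z tt); first by apply: (zF P); left.
move=> [X [dX fX Xz]]; have : (~` X) z.
  apply: zF; right; split; last by rewrite setCK.
  have /definable_over_realsP[W [q [d [dB ->]]]] := dX.
  by apply/definable_over_realsP; exists W, (Neg q), d; split=> //; apply/seteqP; split.
by apply; move: Xz; congr (X _); apply: funext => -[].
Qed.

(** Converse of [acl_rank_full], over any countable set containing the parameters: coordinates are
    chosen one by one, each nonalgebraic over B and the previous ones. *)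
Lemma full_acl_rank (I : finType) (l : seq I) B V (phi : formula L (I + V)) c :
  elim_inf S -> countable B -> (forall v, B (c v)) ->
  full l [set x | sat S phi (tcat x c)] ->
  exists2 a, sat S phi (tcat a c) & acl_rank B [seq a i | i <- l] = size l.
Proof.
move=> elimS; elim: l B V phi c => [|i l IH] B V phi c cB cBv; first by case=> a; exists a.
rewrite full_cons.
have [psi psiP] := full_definable l elimS (Slice i phi).
have psiE b : sat S psi (oapp c b) <-> full l ([set x | sat S phi (tcat x c)] `&` [set x | x i = b]).
  by rewrite (psiP _ _ _ (elementary_id S)) sat_Slice.
move=> inf; have [|b /psiE + nb] := @infinite_definable_nonalgebraic B V psi c cB cBv.
  by apply: contra_not inf; apply: sub_finite_set => b /psiE.
rewrite -sat_Slice => /(IH (b |` B)) [||a hSl ra].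
- by by apply: countableU.
- by case=> [v|]; [right; exact: cBv|left].
have : [set x | sat S (Slice i phi) (tcat x (oapp c b))] a by [].
rewrite sat_Slice => -[ha /= ai]; exists a => //=.
by rewrite ai ra; case: asboolP nb.
Qed.

(** [aleph1_saturated] realizes types in one variable. The tuple is therefore built coordinate by
    coordinate, keeping for each m a solution of [phi m] that agrees with it on the coordinates
    already fixed. *)
Lemma saturated_decreasing (I : finType) B (V : nat -> Type)
    (phi : forall m, formula L (I + V m)) (c : forall m, V m -> T) :
  countable B -> (forall m v, B (c m v)) ->
  (forall m, [set x | sat S (phi m.+1) (tcat x (c m.+1))] `<=`
             [set x | sat S (phi m) (tcat x (c m))]) ->
  (forall m, exists x, sat S (phi m) (tcat x (c m))) ->
  exists x, forall m, sat S (phi m) (tcat x (c m)).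
Proof.
move=> cB cBv dec ne.
suff : forall l : seq I, exists a : I -> T, forall m, exists x,
    sat S (phi m) (tcat x (c m)) /\ {in l, forall i, x i = a i}.
  move=> /(_ (enum I))[a ha]; exists a => m.
  have [x [hx xa]] := ha m; suff <- : x = a by [].
  by apply: funext => i; apply: xa; rewrite mem_enum.
elim=> [|i l [a ha]].
  have [x _] := ne 0%N; exists x => m; have [y hy] := ne m.
  by exists y.
(* [q m] says that x solves [phi m], agrees with a on l, and takes the value of [None] at coordinate
   i. *)
pose q m : formula L (I + (I + option (V m))) :=
  foldr (fun j p => And (Eqv L (inl j) (inr (inl j))) p)
   (And (rename (fun k => match k with inl k => inl k | inr v => inr (inr (Some v)) end)
     (phi m)) (Eqv L (inl i) (inr (inr None)))) l.
have qP m x b : sat S (q m) (tcat x (tcat a (oapp (c m) b))) <->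
    [/\ sat S (phi m) (tcat x (c m)), x i = b & {in l, forall j, x j = a j}].
  rewrite /q; elim: {ha q}l => [|j l IH].
    rewrite [foldr _ _ _]/= sat_And sat_rename; set w := _ \o _.
    have -> : w = tcat x (c m) by apply: tcat_eq.
    by split=> [[? ?]|[? ?]].
  rewrite [foldr _ _ _]/= sat_And IH /=; split=> [[xj [h1 h2 h3]]|[h1 h2 h3]].
    by split=> // k; rewrite inE => /orP[/eqP -> //|/h3].
  split; first by apply: h3; rewrite inE eqxx.
  by split=> // k kl; apply: h3; rewrite inE kl orbT.
have [r rP] : exists r : forall m, formula L (I + option (V m)), forall m b,
    sat S (r m) (tcat a (oapp (c m) b)) <-> exists x,
    [/\ sat S (phi m) (tcat x (c m)), x i = b & {in l, forall j, x j = a j}].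
  have h m : exists r, forall b, sat S r (tcat a (oapp (c m) b)) <-> exists x,
    [/\ sat S (phi m) (tcat x (c m)), x i = b & {in l, forall j, x j = a j}].
    have [r rP] := Ex_tuple (q m); exists r => b; rewrite rP.
    by split=> -[x /qP hx]; exists x.
  by exists (fun m => projT1 (cid (h m))) => m; case: cid.
pose P m := [set z : unit -> T | sat S (r m) (tcat a (oapp (c m) (z tt)))].
have Pdec m k : (m <= k)%N -> P k `<=` P m.
  move=> /subnK <-; elim: (k - m)%N => // j IH z hz; apply: IH.
  move: hz => /rP[x [h1 h2 h3]]; apply/rP; exists x; split=> //; exact: dec.
have [||G GF fG|z zP] := satS (A := B `|` range a) (F := range P).
- apply: countableU => //; apply: finite_set_countable; apply: finite_image; exact: finite_finset.
- move=> _ [m _ <-]; apply/definable_over_realsP.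
  pose s (j : I + option (V m)) : unit + (I + V m) := match j with
    | inl j => inr (inl j) | inr None => inl tt | inr (Some v) => inr (inr v) end.
  exists (I + V m)%type, (rename s (r m)), (tcat a (c m)); split.
    by case=> [j|v]; [right; exists j|left; exact: cBv].
  have sE z : tcat z (tcat a (c m)) \o s = tcat a (oapp (c m) (z tt)).
    by apply: tcat_eq => // -[].
  by apply/seteqP; split=> z; rewrite /P /mkset sat_rename sE.
(* The sets [P m] decrease, so finitely many of them contain a common [P k]. *)
- have [k hk] : exists k, forall X, G X -> P k `<=` X.
    have /choice[f fP] : forall X, exists m, G X -> P m = X.
      move=> X; have [GX|nG] := EM (G X); last by exists 0%N.
      by have [m _ <-] := GF _ GX; exists m.
    have : finite_set (f @` G) by apply: finite_image.
    move=> /finite_seqP[s sE]; exists (\max_(j <- s) j) => X GX.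
    rewrite -(fP _ GX); apply: Pdec; apply: leq_bigmax_seq => //.
    have : (f @` G) (f X) by exists X.
    by rewrite sE.
  have [x [hx xa]] := ha k; exists (fun=> x i) => X /hk; apply.
  by apply/rP; exists x.
exists (fun j => if j == i then z tt else a j) => m.
have /rP[x [h1 h2 h3]] : P m z by apply: zP; exists m.
exists x; split=> // j; rewrite inE; case: eqP => [->//|_] /= jl; exact: h3.
Qed.

End Rank.

(** * Strongly minimal relics *)

Lemma geometric_elim_inf (L : language) (T : Type) (S : structure L T) :
  geometric S -> elim_inf S.
Proof.
move=> [_ geo] V phi.
have [J [s [phi0 <-]]] := formula_support_option phi.
have [psi psiP] := geo _ phi0.
exists (rename s psi) => N SN h hS v; rewrite sat_rename psiP.
  set X := [set x | _]; set Y := [set x | _ ].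
  suff -> : X = Y by [].
  by apply/seteqP; split=> x; rewrite /X /Y /mkset sat_rename oapp_omap.
move=> q; rewrite hS; suff -> : h \o of_void T = of_void N by [].
by apply: funext => -[].
Qed.

Section Relic.
Variables (L : language) (K : topologicalType) (S : structure L K).
Variables (n : nat) (M : set ('I_n -> K)).
Variables (LM : language) (SM : structure LM (set_type M)).
Hypothesis geoS : geometric S.
Hypothesis satS : aleph1_saturated S.
Hypothesis smSM : strongly_minimal SM.
Hypothesis zero_def : zero_definable_sets_are_zero_definable S SM.
Hypothesis infM : infinite_set [set: set_type M].

Let exch : exchange S.
Proof. exact: geoS.1. Qed.
Let elimS : elim_inf S := geometric_elim_inf geoS.

Lemma flat_inj (J : Type) (a b : J -> set_type M) : flat a = flat b -> a = b.
Proof.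
move=> ab; apply: funext => j; apply: val_inj; apply: funext => i.
by have := congr1 (fun f => f (j, i)) ab.
Qed.

(** Parameters are treated as variables, since [zero_def] transfers 0-definable sets; they are then
    recovered from their coordinates by [flat_inj]. *)
Lemma flat_formula (J V : finType) (phi : formula LM (J + V)) :
  exists psi : formula L (J * 'I_n + V * 'I_n), forall y (c : V -> set_type M),
    sat S psi (tcat y (flat c)) <-> exists2 x, y = flat x & sat SM phi (tcat x c).
Proof.
have /zero_def/definable_over0P[psi0 psi0P] : definable_over SM set0 [set z | sat SM phi z].
  by apply/definable_over0P; exists phi.
pose s (p : (J + V) * 'I_n) : J * 'I_n + V * 'I_n :=
  match p.1 with inl j => inl (j, p.2) | inr v => inr (v, p.2) end.
exists (rename s psi0) => y c; rewrite sat_rename.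
have E : sat S psi0 (tcat y (flat c) \o s) <->
    (@flat K n M (J + V) @` [set z | sat SM phi z]) (tcat y (flat c) \o s).
  by rewrite psi0P.
rewrite E; split=> [[z hz zE]|[x -> hx]]; last first.
  by exists (tcat x c) => //; apply: funext => -[[j|v] i].
have zr : z \o inr = c.
  apply: flat_inj; apply: funext => -[v i].
  by have := congr1 (fun f => f (inr v, i)) zE.
exists (z \o inl); last by rewrite -zr -[tcat _ _](_ : z = _) //; apply: tcat_eq.
by apply: funext => -[j i]; have := congr1 (fun f => f (inl j, i)) zE.
Qed.

Lemma finite_definable_acl (J V : finType) (phi : formula LM (J + V)) c x (B : set K) :
  (forall p, B (flat c p)) -> finite_set [set x | sat SM phi (tcat x c)] ->
  sat SM phi (tcat x c) -> forall p, acl S (reals B) (flat x p).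
Proof.
move=> cB fin hx p.
have [psi psiP] := flat_formula phi.
have [q qP] := Ex_tuple (Slice p psi).
have qE b : sat S q (oapp (flat c) b) <-> exists2 x, sat SM phi (tcat x c) & flat x p = b.
  rewrite qP; split=> [[y hy]|[x' h1 h2]].
    have : [set y | sat S (Slice p psi) (tcat y (oapp (flat c) b))] y by [].
    by rewrite sat_Slice => -[/psiP[x' -> ?] <-]; exists x'.
  exists (flat x').
  suff : [set y | sat S (Slice p psi) (tcat y (oapp (flat c) b))] (flat x') by [].
  by rewrite sat_Slice; split=> //; apply/psiP; exists x'.
apply/acl_realsP; exists (V * 'I_n)%type, q, (flat c); split=> //.
  apply: sub_finite_set (finite_image (fun x => flat x p) fin) => b /qE[x' h1 h2].
  by exists x'.
by apply/qE; exists x.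
Qed.

Lemma elementary_inj (N : Type) (SN : structure LM N) (h : set_type M -> N) :
  elementary SM SN h -> injective h.
Proof.
move=> hS a b hab; exact/(hS bool (Eqv LM true false) (fun i => if i then a else b)).
Qed.

(** If for every m some b had at least m solutions and m non-solutions, saturation of K would give
    one b with infinitely many of both, against strong minimality. So this fails for some m, in M
    and then in every elementary extension; the latter being infinite, a finite fibre has an
    infinite complement and hence fewer than m elements. *)
Lemma relic_bounded : bounded_finite_fibers SM.
Proof.
move=> V phi.
have [J [s [phi0 <-]]] := formula_support_option phi.
pose delta m : formula LM J := And (AtLeast m phi0) (AtLeast m (Neg phi0)).
have deltaP m T (ST : structure LM T) b : sat ST (delta m) b <->
    at_least m [set x | sat ST phi0 (oapp b x)] /\
    at_least m (~` [set x | sat ST phi0 (oapp b x)]).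
  by rewrite sat_And !sat_AtLeast.
have [m mP] : exists m, forall b, ~ sat SM (delta m) b.
  apply: contrapT => /forallNP hn.
  have hb m : exists b, sat SM (delta m) b.
    by have /existsNP[b /contrapT hb] := hn m; exists b.
  have hpsi m : exists psi : formula L (J * 'I_n + void * 'I_n), forall y,
      sat S psi (tcat y (flat (of_void (set_type M)))) <->
      exists2 x, y = flat x & sat SM (delta m) x.
    have [psi psiP] := flat_formula (rename (inl : J -> J + void) (delta m)).
    exists psi => y; rewrite psiP.
    by split=> -[x ? hx]; exists x => //; move: hx; rewrite sat_rename.
  have [psi psiP] := choice hpsi.
  have := @saturated_decreasing _ _ S satS _ set0 (fun=> void * 'I_n)%type psi
     (fun=> flat (of_void (set_type M))) (countable0 K).
  case=> [m [[]]|m y|m|y hy].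
  - move=> /psiP[x -> /deltaP[h1 h2]]; apply/psiP; exists x => //.
    by apply/deltaP; split; apply: at_leastW.
  - by have [b hbm] := hb m; exists (flat b); apply/psiP; exists b.
  - have /psiP[x yx _] := hy 0%N.
    have hx m : sat SM (delta m) x.
      by have /psiP[x' + hx'] := hy m; rewrite yx => /flat_inj ->.
    case: (strongly_minimalP smSM (elementary_id SM) phi0 x); apply/at_least_infinite => m;
      by have /deltaP[] := hx m.
exists m => N SN h hS v.
have -> : [set x | sat SN (rename (omap s) phi0) (oapp v x)] =
   [set x | sat SN phi0 (oapp (v \o s) x)].
  by apply/seteqP; split=> x; rewrite /mkset sat_rename oapp_omap.
move=> h1 fin.
have [q qP] := Ex_tuple (rename (inl : J -> J + void) (delta m)).
have : ~ sat SN q (of_void N).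
  have -> : of_void N = h \o of_void (set_type M) by apply: funext => -[].
  by rewrite -hS qP => -[b]; rewrite sat_rename => /mP.
apply; apply/qP; exists (v \o s); apply/sat_rename/deltaP; split=> //.
apply: infinite_at_least => fin'; apply: infM.
have : finite_set [set: N] by rewrite -(setUv [set x | sat SN phi0 (oapp (v \o s) x)]) finite_setU.
move=> fN; apply: sub_finite_set (finite_preimage (in2W (elementary_inj hS)) fN); exact: subsetT.
Qed.

Let elimSM : elim_inf SM := bounded_elim_inf relic_bounded.

(** * Coordinates in K of tuples of M *)

Definition coords (l : seq (set_type M)) : seq K :=
  flatten [seq [seq val a i | i <- enum 'I_n] | a <- l].

Lemma coords_cons a l : coords (a :: l) = [seq val a i | i <- enum 'I_n] ++ coords l.
Proof. by []. Qed.

Lemma coords_cat l l' : coords (l ++ l') = coords l ++ coords l'.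
Proof. by rewrite /coords map_cat flatten_cat. Qed.

Lemma coordsE (J : eqType) (x : J -> set_type M) l :
  coords [seq x j | j <- l] = [seq flat x p | p <- allpairs pair l (enum 'I_n)].
Proof.
elim: l => //= j l IH; rewrite coords_cons IH map_cat; congr (_ ++ _).
by rewrite -map_comp.
Qed.

Lemma mem_coords (J : eqType) (x : J -> set_type M) (l : seq J) (y : K) :
  y \in coords [seq x j | j <- l] -> exists p, y = flat x p.
Proof. by rewrite coordsE => /mapP[p _ ->]; exists p. Qed.

Lemma flat_in_coords (J : finType) (x : J -> set_type M) p :
  flat x p \in coords [seq x j | j <- enum J].
Proof.
rewrite coordsE; apply: map_f; case: p => j i.
by apply/allpairsP; exists (j, i); rewrite !mem_enum.
Qed.

Lemma range_flat (J : finType) (x : J -> set_type M) :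
  range (flat x) = [set` coords [seq x j | j <- enum J]].
Proof.
apply/seteqP; split=> [_ [p _ <-]|y /mem_coords[p ->]]; last by exists p.
exact: flat_in_coords.
Qed.

Lemma coords_sub (J : finType) (x : J -> set_type M) (l : seq J) :
  {subset coords [seq x j | j <- l] <= coords [seq x j | j <- enum J]}.
Proof. by move=> y /mem_coords[p ->]; exact: flat_in_coords. Qed.

Lemma enum_prod_perm (J : finType) :
  perm_eq (enum {: J * 'I_n}) (allpairs pair (enum J) (enum 'I_n)).
Proof.
apply: uniq_perm; first exact: enum_uniq.
  by apply: allpairs_uniq; rewrite ?enum_uniq // => -[? ?] [? ?].
move=> [j i]; rewrite mem_enum; apply/esym/allpairsP.
by exists (j, i); rewrite !mem_enum.
Qed.

Lemma dim_flat (J : finType) (x : J -> set_type M) (B : set K) :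
  dim S (reals B) (flat x) = acl_rank S B (coords [seq x j | j <- enum J]).
Proof.
rewrite dimE // coordsE; apply: acl_rank_perm => //; apply: perm_map; exact: enum_prod_perm.
Qed.

Lemma enum_sum_perm (I J : finType) :
  perm_eq (enum {: I + J}) ([seq inl i | i <- enum I] ++ [seq inr j | j <- enum J]).
Proof.
apply: uniq_perm; first exact: enum_uniq.
  rewrite cat_uniq; apply/and3P; split.
  - by rewrite map_inj_uniq; [exact: enum_uniq|move=> ? ? []].
  - by apply/hasPn => _ /mapP[j _ ->]; apply/mapP => -[].
  - by rewrite map_inj_uniq; [exact: enum_uniq|move=> ? ? []].
move=> [i|j]; rewrite mem_enum mem_cat; apply/esym/orP.
  by left; apply: map_f; rewrite mem_enum.
by right; apply: map_f; rewrite mem_enum.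
Qed.

Lemma dim_tcat (I J : finType) (y : I -> K) (z : J -> K) (B : set K) :
  dim S (reals B) (tcat y z) =
  acl_rank S B ([seq y i | i <- enum I] ++ [seq z j | j <- enum J]).
Proof.
rewrite dimE // (acl_rank_perm exch B (perm_map _ (enum_sum_perm I J))).
by rewrite map_cat -!map_comp.
Qed.

Lemma dim_tcat_flat (I J : finType) (x : I -> set_type M) (t : J -> set_type M) (B : set K) :
  dim S (reals B) (tcat (flat x) (flat t)) =
  acl_rank S B (coords ([seq x j | j <- enum I] ++ [seq t j | j <- enum J])).
Proof.
rewrite dim_tcat coords_cat !acl_rank_cat; congr (_ + _)%N.
  by rewrite !coordsE; apply: acl_rank_perm => //; apply: perm_map; exact: enum_prod_perm.
have -> : [set` [seq flat x i | i <- enum {: I * 'I_n}]] =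
    [set` coords [seq x j | j <- enum I]].
  rewrite -range_flat; apply/seteqP; split=> [y /mapP[p _ ->]|_ [p _ <-]]; first by exists p.
  by apply: map_f; rewrite mem_enum.
by rewrite !coordsE; apply: acl_rank_perm => //; apply: perm_map; exact: enum_prod_perm.
Qed.

(** * Comparison of Morley rank with dimension *)

Let d := dim_set S set0 M.

Lemma acl_rank_coords1 (a : set_type M) B : (acl_rank S B (coords [:: a]) <= d)%N.
Proof.
apply: (@leq_trans (acl_rank S set0 (coords [:: a]))).
  by apply: acl_rank_mono; exact: sub0set.
rewrite /coords /= cats0 -dimE // /d -(reals0 K).
by apply: dim_le_dim_set => //; apply: set_valP.
Qed.

Lemma acl_rank_coords l B : (acl_rank S B (coords l) <= size l * d)%N.
Proof.
elim: l B => // a l IH B; rewrite -cat1s coords_cat acl_rank_cat mulSn.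
by apply: leq_add; [exact: acl_rank_coords1|exact: IH].
Qed.

(** A point of maximal dimension over the empty set makes M full along a basis of its coordinates;
    saturation then gives a point independent over B along that basis. *)
Lemma generic_point B : countable B -> exists a, acl_rank S B (coords [:: a]) = d.
Proof.
move=> cB.
have [psi psiP] := flat_formula (Neg Falsum : formula LM (unit + void)).
have [_ [a0 _ <-] a0d] : exists2 x, (range (val : set_type M -> _)) x & acl_rank S set0 [seq x i | i <- enum 'I_n] = d.
  have [a _] := infinite_nonempty infM.
  have [x Mx] := @dim_set_attained _ _ S exch set0 _ M (ex_intro _ (val a) (set_valP a)).
  rewrite reals0 -/d => <-; exists x; first by exists (exist _ x (mem_set Mx)).
  by rewrite -dimE // reals0.
have [l [ls _ lr _]] := acl_rank_basis S set0 (flat (fun=> a0 : set_type M)) (enum_uniq {: unit * 'I_n}).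
have ld : size l = d.
  rewrite ls -dimE // dim_flat -a0d; congr acl_rank.
  by rewrite enumT unlock /= /coords /= cats0.
have fl := @acl_rank_full _ _ S _ l set0 _ psi (flat (of_void _)) (flat (fun=> a0)) elimS.
have [||y /psiP[x -> _] hr] := @full_acl_rank _ _ S satS _ l B _ psi (flat (of_void (set_type M))) elimS cB.
- by case=> -[].
- apply: fl => //; first by case=> -[].
  by apply/psiP; exists (fun=> a0) => // ?.
exists (x tt); apply/eqP; rewrite eqn_leq acl_rank_coords1 -ld -hr.
apply: acl_rank_sub => // _ /mapP[[[] i] _ ->].
by rewrite /coords /= cats0; apply: map_f; rewrite mem_enum.
Qed.

(** M is infinite, so some coordinate takes infinitely many values and saturation provides a
    nonalgebraic one. *)
Lemma d_gt0 : (0 < d)%N.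
Proof.
rewrite lt0n; apply/eqP => d0.
have [psi psiP] := flat_formula (Neg Falsum : formula LM (unit + void)).
have iM : infinite_set [set y | sat S psi (tcat y (flat (of_void (set_type M))))].
  apply: contra_not infM => fin.
  have inj_f : injective (fun a : set_type M => flat (fun _ : unit => a)).
    by move=> a b /flat_inj/(congr1 (fun f => f tt)).
  apply: sub_finite_set (finite_preimage (in2W inj_f) fin) => a _.
  by apply/psiP; exists (fun=> a) => // ?.
have [i hi] := infinite_values iM.
have [|||y /psiP[x -> _] /=] := @full_acl_rank _ _ S satS _ [:: i] set0 _ psi (flat (of_void (set_type M))) elimS.
- exact: countable0.
- by case=> -[].
- rewrite full_cons; apply: contra_not hi; apply: sub_finite_set => a [y h1 h2].
  by exists y.
case: asboolP => //= na _; apply: na.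
case: i {hi} => -[] i /=.
have := acl_rank_coords [:: x tt] set0; rewrite d0 muln0 leqn0 => /eqP h0.
have : (acl_rank S set0 [:: val (x tt) i] <= 0)%N.
  rewrite -h0; apply: acl_rank_sub => // z; rewrite inE => /eqP ->.
  by rewrite /coords /= cats0; apply: map_f; rewrite mem_enum.
by rewrite /= addn0; case: asboolP.
Qed.

Definition unit_renaming (V : Type) (i : option V) : unit + V :=
  if i is Some v then inr v else inl tt.

Lemma finite_definable_rank0 (V : finType) (psi : formula LM (option V)) c a (B : set K) :
  (forall p, B (flat c p)) -> finite_set [set b | sat SM psi (oapp c b)] ->
  sat SM psi (oapp c a) -> acl_rank S B (coords [:: a]) = 0%N.
Proof.
move=> cB fin ha; apply: acl_rank_eq0 => y.
have /= h := @finite_definable_acl unit V (rename (@unit_renaming V) psi) c (fun=> a) B cB.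
rewrite /coords /= cats0 => /mapP[i _ ->].
have E (z : unit -> set_type M) : tcat z c \o @unit_renaming V = oapp c (z tt) by apply: oapp_eq.
apply: (h _ _ (tt, i)); last by rewrite sat_rename E.
rewrite -(finite_preim_tt [set b | sat SM psi (oapp c b)]) in fin.
by apply: sub_finite_set fin => z /=; rewrite sat_rename E.
Qed.

(** An infinite definable subset of M is cofinite, and the finitely many missing points have
    dimension 0 over B while d > 0. So a point generic over B is a possible value of the first
    coordinate, and each coordinate along [l] contributes d. *)
Lemma full_coords_rank (J V : finType) (l : seq J) (phi : formula LM (J + V)) c (B : set K) :
  countable B -> (forall p, B (flat c p)) -> full l [set x | sat SM phi (tcat x c)] ->
  exists2 x, sat SM phi (tcat x c) &
    acl_rank S B (coords [seq x j | j <- l]) = (size l * d)%N.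
Proof.
elim: l V phi c B => [|i l IH] V phi c B cB cBp; first by case=> x; exists x.
rewrite full_cons => inf.
have [psi psiP] := full_definable l elimSM (Slice i phi).
have psiE b : sat SM psi (oapp c b) <-> full l ([set x | sat SM phi (tcat x c)] `&` [set x | x i = b]).
  by rewrite (psiP _ _ _ (elementary_id SM)) sat_Slice.
have cof : finite_set (~` [set b | sat SM psi (oapp c b)]).
  have [fin|//] := strongly_minimalP smSM (elementary_id SM) psi c.
  by exfalso; apply: inf; apply: sub_finite_set fin => b /psiE.
have [b bd] := generic_point cB.
have /psiE : sat SM psi (oapp c b).
  apply: contrapT => nb.
  have := @finite_definable_rank0 V (Neg psi) c b B cBp cof nb.
  by rewrite bd => d0; have := d_gt0; rewrite d0.
rewrite -sat_Slice => /(IH _ _ _ (B `|` [set` coords [:: b]])) [||x hx xr].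
- by apply: countableU => //; apply: finite_set_countable; exact: finite_seq.
- case=> -[v|] k; first by left; exact: (cBp (v, k)).
  by right; rewrite /coords /= cats0; apply: map_f; rewrite mem_enum.
have : [set x | sat SM (Slice i phi) (tcat x (oapp c b))] x by [].
rewrite sat_Slice => -[h1 /= xi]; exists x => //.
by rewrite -[coords _]/(coords ([:: x i] ++ [seq x j | j <- l])) coords_cat acl_rank_cat xi bd xr mulSn.
Qed.

(** A converse with slack: dimension above (size l - 1)d suffices, because a first coordinate in a
    finite definable set contributes 0 and the others at most d each. The slack is what lets
    M-dependence of t and u bound dim(tu) by 3d. *)
Lemma coords_rank_full (J V : finType) (l : seq J) (phi : formula LM (J + V)) c (B : set K) x :
  (forall p, B (flat c p)) -> sat SM phi (tcat x c) ->
  (size l * d < acl_rank S B (coords [seq x j | j <- l]) + d)%N ->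
  full l [set x | sat SM phi (tcat x c)].
Proof.
elim: l V phi c B => [|i l IH] V phi c B cBp hx; first by exists x.
rewrite -[coords _]/(coords ([:: x i] ++ [seq x j | j <- l])) coords_cat acl_rank_cat /= mulSn => hr.
rewrite full_cons.
have [psi psiP] := full_definable l elimSM (Slice i phi).
have psiE b : sat SM psi (oapp c b) <-> full l ([set x | sat SM phi (tcat x c)] `&` [set x | x i = b]).
  by rewrite (psiP _ _ _ (elementary_id SM)) sat_Slice.
have hi : sat SM psi (oapp c (x i)).
  apply/(psiP _ _ _ (elementary_id SM)); apply: (IH _ _ _ (B `|` [set` coords [:: x i]])).
  - case=> -[v|] k; first by left; exact: (cBp (v, k)).
    by right; rewrite /coords /= cats0; apply: map_f; rewrite mem_enum.
  - suff : [set y | sat SM (Slice i phi) (tcat y (oapp c (x i)))] x by [].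
    by rewrite sat_Slice.
  - rewrite -(ltn_add2l d); apply: leq_trans hr _.
    by rewrite addnA leq_add2r leq_add2r acl_rank_coords1.
move=> fin; move: hr.
rewrite (@finite_definable_rank0 V psi c (x i) B cBp _ hi).
  rewrite add0n addnC ltn_add2r ltnNge -(size_map x l).
  by rewrite acl_rank_coords.
by apply: sub_finite_set fin => b /psiE.
Qed.

(** The hypothesis makes every 0-definable set containing x full along all coordinates. The whole
    power has no larger rank, since a full list of length |J| + 1 would produce a tuple of dimension
    (|J| + 1)d. *)
Lemma tuple_rank_max (J : finType) (x : J -> set_type M) :
  (#|J| * d < acl_rank S set0 (coords [seq x j | j <- enum J]) + d)%N ->
  tuple_rank SM set0 x #|J|.
Proof.
move=> hx; split.
  exists setT; split=> //.
    by apply/definable_over0P; exists (Neg Falsum); apply/seteqP; split=> // y _ [].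
  have E : setT = realizations SM (Neg Falsum : formula LM (J + set_type M)).
    by apply/seteqP; split=> // y _ [].
  split.
    exists (Neg Falsum) => //; rewrite cardE; apply: full_formula_rank_ge.
    rewrite -E.
    have := @coords_rank_full J void (enum J) (Neg Falsum) (of_void _) set0 x.
    rewrite -cardE => h; apply: full_sub (h _ _ hx) => //; first by case=> -[].
  case=> phi phiT.
  move=> /(formula_rank_ge_full relic_bounded smSM (elementary_id SM))[l lJ].
  rewrite -phiT => hl.
  have [||y _] := @full_coords_rank J void l (Neg Falsum) (of_void _) set0 (countable0 K).
  - by case=> -[].
  - by apply: full_sub hl => y _ [].
  rewrite lJ => h.
  have : ((#|J|.+1) * d <= #|J| * d)%N.
    rewrite -h [in leqRHS]cardE -(size_map y); apply: leq_trans (acl_rank_coords _ _).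
    by apply: acl_rank_sub => //; exact: coords_sub.
  by rewrite leq_mul2r ltnn orbF => /eqP d0; have := d_gt0; rewrite d0.
move=> X /definable_over0P[phi ->] Xx.
pose g (i : J) : J + set_type M := inl i.
exists (rename g phi).
  by apply/seteqP; split=> y; rewrite /realizations /mkset sat_rename.
rewrite cardE; apply: full_formula_rank_ge.
have := @coords_rank_full J void (enum J) (rename inl phi) (of_void _) set0 x.
rewrite sat_rename -cardE => h.
apply: full_sub (h _ Xx hx); last by case=> -[].
by move=> y; rewrite /realizations /mkset !sat_rename.
Qed.

(** * Plane curves *)

Notation coords_of x := [seq x j | j <- enum 'I_2].
Notation rk B l := (acl_rank S B (coords l)).

Lemma size_coords_of (x : 'I_2 -> set_type M) : size (coords_of x) = 2.
Proof. by rewrite size_map size_enum_ord. Qed.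

Lemma acl_rank_pair x B : (rk B (coords_of x) <= 2 * d)%N.
Proof. by have := acl_rank_coords (coords_of x) B; rewrite size_coords_of. Qed.

Lemma coords_set_cat l l' : [set` coords (l ++ l')] = [set` coords l] `|` [set` coords l'].
Proof.
rewrite coords_cat; apply/seteqP; split=> y /=; rewrite mem_cat.
  by case/orP; [left|right].
by case=> /= ->; rewrite ?orbT.
Qed.

Lemma rank_cat0 l l' : rk set0 (l ++ l') = (rk set0 l + rk [set` coords l] l')%N.
Proof. by rewrite coords_cat acl_rank_cat set0U. Qed.

Lemma rank_cat l0 l l' : rk [set` coords l0] (l ++ l') =
  (rk [set` coords l0] l + rk [set` coords (l0 ++ l)] l')%N.
Proof. by rewrite coords_cat acl_rank_cat coords_set_cat. Qed.

Lemma rank_catC B l l' : rk B (l ++ l') = rk B (l' ++ l).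
Proof. by rewrite !coords_cat acl_rank_catC. Qed.

Lemma countable_coords l : countable [set` coords l].
Proof. by apply: finite_set_countable; exact: finite_seq. Qed.

Lemma flat_in_coords_set (J : finType) (x : J -> set_type M) p :
  [set` coords [seq x j | j <- enum J]] (flat x p).
Proof. exact: flat_in_coords. Qed.

Lemma finite_definable_pair_rank0 (V : finType) (phi : formula LM ('I_2 + V)) c x (B : set K) :
  (forall p, B (flat c p)) -> finite_set [set x | sat SM phi (tcat x c)] ->
  sat SM phi (tcat x c) -> rk B (coords_of x) = 0%N.
Proof.
move=> cB fin hx; apply: acl_rank_eq0 => y /mem_coords[p ->].
exact: finite_definable_acl fin hx p.
Qed.

Lemma rank_ge_full (J : finType) (X : set (J -> set_type M)) k :
  rank_ge SM X k -> exists2 l : seq J, size l = k & full l X.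
Proof.
by move=> [phi ->] /(formula_rank_ge_full relic_bounded smSM (elementary_id SM)).
Qed.

Lemma full_rank_ge (J : finType) (V : Type) (phi : formula LM (J + V)) c l :
  full l [set x | sat SM phi (tcat x c)] ->
  rank_ge SM [set x | sat SM phi (tcat x c)] (size l).
Proof.
pose s (i : J + V) := match i with inl i => inl i | inr v => inr (c v) end.
have sE : [set x | sat SM phi (tcat x c)] = realizations SM (rename s phi).
  apply/seteqP; split=> x; rewrite /realizations /mkset sat_rename;
  set w := _ \o _; by (have -> : w = tcat x c by apply: tcat_eq).
by rewrite sE => h; exists (rename s phi) => //; apply: full_formula_rank_ge.
Qed.

(** Finite-to-one projection makes x algebraic over c and its first coordinate, and one point of M
    contributes at most d. *)
Lemma nontrivial_curve_rank_le (V : finType) (phi : formula LM ('I_2 + V)) c x (B : set K) :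
  (forall p, B (flat c p)) ->
  nontrivial_plane_curve SM [set x | sat SM phi (tcat x c)] ->
  sat SM phi (tcat x c) -> (rk B (coords_of x) <= d)%N.
Proof.
move=> cB [_ fin] hx.
pose s (i : 'I_2 + V) : 'I_2 + (V + unit) := match i with inl i => inl i | inr v => inr (inl v) end.
pose theta := And (rename s phi) (Eqv LM (inl ord0) (inr (inr tt))).
pose c' := tcat c (fun _ : unit => x ord0).
have thetaP y : sat SM theta (tcat y c') <-> sat SM phi (tcat y c) /\ y ord0 = x ord0.
  rewrite sat_And sat_rename; set w := _ \o _.
  by have -> : w = tcat y c by apply: tcat_eq.
apply: (@leq_trans (rk B ([:: x ord0] ++ coords_of x))).
  by apply: acl_rank_sub => // y; rewrite coords_cat mem_cat orbC => ->.
rewrite coords_cat acl_rank_cat (@finite_definable_pair_rank0 _ theta c').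
- by rewrite addn0 acl_rank_coords1.
- case=> -[v|[]] i; first by left; exact: (cB (v, i)).
  by right; rewrite /coords /= cats0; apply: map_f; rewrite mem_enum.
- by apply: sub_finite_set (fin ord0 (x ord0)) => y /thetaP.
- exact/thetaP.
Qed.

Lemma nontrivial_curve_generic (V : finType) (phi : formula LM ('I_2 + V)) c (B : set K) :
  countable B -> (forall p, B (flat c p)) ->
  nontrivial_plane_curve SM [set x | sat SM phi (tcat x c)] ->
  exists2 x, sat SM phi (tcat x c) & rk B (coords_of x) = d.
Proof.
move=> cB cBp nt; have [[_ [/rank_ge_full[l l1 fl] _]] _] := nt.
have [x hx xr] := full_coords_rank cB cBp fl.
exists x => //; apply/eqP; rewrite eqn_leq (nontrivial_curve_rank_le cBp nt hx) /=.
have <- : rk B [seq x j | j <- l] = d by rewrite xr l1 mul1n.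
by apply: acl_rank_sub => //; exact: coords_sub.
Qed.

(** * Excellent families *)

Section Family.
Variable C : set_family (set_type M) 'I_2 'I_2.
Hypothesis exC : excellent_family SM set0 C.
Variables (phiT : formula LM 'I_2) (phiG : formula LM ('I_2 + 'I_2)).
Hypothesis phiTP : forall t, sat SM phiT t <-> base C t.
Hypothesis phiGP : forall x t, sat SM phiG (tcat x t) <-> base C t /\ C t x.

Definition swap_sum (I J : Type) (k : J + I) : I + J :=
  match k with inl j => inr j | inr i => inl i end.

Lemma tcat_swap_sum (I J T : Type) (x : I -> T) (y : J -> T) :
  tcat x y \o @swap_sum I J = tcat y x.
Proof. by apply: tcat_eq. Qed.

Definition phiG' := rename (@swap_sum 'I_2 'I_2) phiG.

Lemma phiG'P t x : sat SM phiG' (tcat t x) <-> base C t /\ C t x.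
Proof. by rewrite /phiG' sat_rename tcat_swap_sum phiGP. Qed.

Lemma curveE t : base C t -> [set x | sat SM phiG (tcat x t)] = C t.
Proof.
by move=> Tt; apply/seteqP; split=> x; rewrite /mkset phiGP => // -[].
Qed.

Lemma indices_atE x : [set t | sat SM phiG' (tcat t x)] = indices_at C x.
Proof. by apply/seteqP; split=> t; rewrite /mkset phiG'P. Qed.

Lemma curve_nontrivial t : base C t ->
  nontrivial_plane_curve SM [set x | sat SM phiG (tcat x t)].
Proof. by move=> Tt; rewrite curveE //; have [_ _ _ + _] := exC; apply. Qed.

Lemma indices_nontrivial x t : base C t -> C t x ->
  nontrivial_plane_curve SM [set t | sat SM phiG' (tcat t x)].
Proof.
move=> Tt Ctx; rewrite indices_atE; have [_ _ _ _ /(_ x)[h|//]] := exC.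
by have : indices_at C x t by []; rewrite h.
Qed.

Lemma curve_rank_le t x (B : set K) : base C t -> C t x ->
  [set` coords (coords_of t)] `<=` B -> (rk B (coords_of x) <= d)%N.
Proof.
move=> Tt Ctx tB; apply: (nontrivial_curve_rank_le (c := t)) (curve_nontrivial Tt) _.
  by move=> p; apply/tB/flat_in_coords.
exact/phiGP.
Qed.

Lemma indices_rank_le t x (B : set K) : base C t -> C t x ->
  [set` coords (coords_of x)] `<=` B -> (rk B (coords_of t) <= d)%N.
Proof.
move=> Tt Ctx tB; apply: (nontrivial_curve_rank_le (c := x)) (indices_nontrivial Tt Ctx) _.
  by move=> p; apply/tB/flat_in_coords.
exact/phiG'P.
Qed.

Lemma finite_intersection_rank t u x (B : set K) :
  base C t -> base C u -> C t x -> C u x -> finite_set (C t `&` C u) ->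
  [set` coords (coords_of t ++ coords_of u)] `<=` B -> rk B (coords_of x) = 0%N.
Proof.
move=> Tt Tu Ctx Cux fin tuB.
pose s1 (i : 'I_2 + 'I_2) : 'I_2 + ('I_2 + 'I_2) := match i with inl i => inl i | inr j => inr (inl j) end.
pose s2 (i : 'I_2 + 'I_2) : 'I_2 + ('I_2 + 'I_2) := match i with inl i => inl i | inr j => inr (inr j) end.
have E1 y : tcat y (tcat t u) \o s1 = tcat y t by apply: tcat_eq.
have E2 y : tcat y (tcat t u) \o s2 = tcat y u by apply: tcat_eq.
have thetaP y : sat SM (And (rename s1 phiG) (rename s2 phiG)) (tcat y (tcat t u)) <->
    C t y /\ C u y.
  rewrite sat_And !sat_rename E1 E2 !phiGP.
  by split=> [[[_ ?] [_ ?]]|[]].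
apply: (finite_definable_pair_rank0 (c := tcat t u)) (proj2 (thetaP x) _) => //.
  move=> [[j|j] i]; apply: tuB; rewrite coords_set_cat; [left|right].
    exact: (flat_in_coords t (j, i)).
  exact: (flat_in_coords u (j, i)).
by apply: sub_finite_set fin => y /thetaP.
Qed.

Lemma full_behead (J : eqType) (U : Type) (i : J) l (X : set (J -> U)) :
  full (i :: l) X -> full l X.
Proof.
rewrite full_cons => /infinite_nonempty[a]; apply: full_sub; exact: subIsetl.
Qed.

Lemma full_drop (J : eqType) (U : Type) k l (X : set (J -> U)) :
  full l X -> full (drop k l) X.
Proof. by elim: l k => [|i l IH] [|k] // h; apply: IH; exact: full_behead h. Qed.

(** The v for which C_t and C_v meet in a set full along a fixed coordinate form a set definable
    over t, finite by almost faithfulness. Since almost faithfulness only names some common rank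
    [d0], this rank must first be shown to be 1. *)
Lemma infinite_intersection_rank t u (B : set K) :
  base C t -> base C u -> infinite_set (C t `&` C u) ->
  [set` coords (coords_of t)] `<=` B -> rk B (coords_of u) = 0%N.
Proof.
move=> Tt Tu inf tB.
have [_ [d0 [rkC fin]] _ _ _] := exC.
have rk1 v : base C v -> rank SM (C v) 1 
  by move=> Tv; have [_ _ _ h _] := exC; have [[]] := h _ Tv.
have d1 : d0 = 1%N.
  have [/rank_ge_full[l ld fl] nd] := rkC _ Tt; have [ge1 nge2] := rk1 _ Tt.
  (* A longer full list has a full tail of length 2, which would give rank at least 2. *)
  have [d0_gt1|] := ltnP 1 d0.
    exfalso; apply: nge2.
    suff : rank_ge SM (C t) (size (drop (d0 - 2) l)) by rewrite size_drop ld subKn.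
    rewrite -(curveE Tt); apply: full_rank_ge; rewrite (curveE Tt); exact: full_drop.
  by case: d0 nd {rkC fin ld} => [|[|]].
rewrite {d0}d1 in rkC fin.
pose s1 (i : 'I_2 + 'I_2) : 'I_2 + ('I_2 + 'I_2) := match i with inl i => inl i | inr j => inr (inr j) end.
pose s2 (i : 'I_2 + 'I_2) : 'I_2 + ('I_2 + 'I_2) := match i with inl i => inl i | inr j => inr (inl j) end.
pose theta := And (rename s1 phiG) (rename s2 phiG).
have E1 y v : tcat y (tcat v t) \o s1 = tcat y t by apply: tcat_eq.
have E2 y v : tcat y (tcat v t) \o s2 = tcat y v by apply: tcat_eq.
have thetaE v : base C v -> [set y | sat SM theta (tcat y (tcat v t))] = C t `&` C v.
  move=> Tv; apply/seteqP; split=> y; rewrite /mkset sat_And !sat_rename E1 E2 !phiGP.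
    by case=> -[_ ?] [_ ?].
  by case.
have rank1 v i : base C v -> full [:: i] (C t `&` C v) -> rank SM (C t `&` C v) 1.
  move=> Tv fi; split.
    by rewrite -(thetaE v Tv) in fi *; exact: full_rank_ge fi.
  move=> /rank_ge_full[l l2 /(full_sub (@subIsetl _ _ _)) fl].
  have [_] := rk1 _ Tt; apply.
  suff : rank_ge SM (C t) (size l) by rewrite l2.
  rewrite -(curveE Tt).
  by apply: full_rank_ge; rewrite curveE.
have [i hi] := infinite_values inf.
have fi : full [:: i] (C t `&` C u).
  by rewrite full_cons; apply: contra_not hi; apply: sub_finite_set => a [y h1 h2]; exists y.
have [psi psiP] := full_definable [:: i] elimSM theta.
have chiP v : sat SM (And (rename inl phiT) psi) (tcat v t) <->
    base C v /\ full [:: i] (C t `&` C v).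
  rewrite sat_And sat_rename phiTP (psiP _ _ _ (elementary_id SM)).
  by split=> -[Tv]; [rewrite -(thetaE v Tv)|rewrite -(thetaE v Tv)].
apply: (finite_definable_pair_rank0 (c := t)) (proj2 (chiP u) _) => //.
  by move=> p; apply/tB/flat_in_coords.
apply: sub_finite_set (fin _ Tt) => v /chiP[Tv fv].
by split=> //; apply: rank1 fv.
Qed.

Lemma generic_index : exists2 t, base C t & rk set0 (coords_of t) = (2 * d)%N.
Proof.
have [_ _ [/rank_ge_full[l l2 fl] _] _ _] := exC.
have TE : [set t | sat SM (rename inl phiT) (tcat t (of_void (set_type M)))] = base C.
  by apply/seteqP; split=> t; rewrite /mkset sat_rename phiTP.
rewrite -TE in fl.
have [||t ht tr] := full_coords_rank (B := set0) _ _ fl.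
- exact: countable0.
- by case=> -[].
exists t; first by move: ht; rewrite sat_rename phiTP.
apply/eqP; rewrite eqn_leq acl_rank_pair /=.
have <- : rk set0 [seq t j | j <- l] = (2 * d)%N by rewrite tr l2.
by apply: acl_rank_sub => //; exact: coords_sub.
Qed.

Lemma graph_rank_le t x : base C t -> C t x ->
  (rk set0 (coords_of x ++ coords_of t) <= 3 * d)%N.
Proof.
move=> Tt Ctx; rewrite rank_catC rank_cat0 -[3]/(2 + 1)%N mulnDl mul1n.
by apply: leq_add; [exact: acl_rank_pair|apply: (curve_rank_le Tt)].
Qed.

Lemma generic_incidence : exists x t, [/\ base C t, C t x,
  rk set0 (coords_of x) = (2 * d)%N, rk set0 (coords_of t) = (2 * d)%N &
  rk set0 (coords_of x ++ coords_of t) = (3 * d)%N].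
Proof.
have [t Tt tr] := generic_index.
have [||x /phiGP[_ Ctx] xr] := @nontrivial_curve_generic _ phiG t [set` coords (coords_of t)] _ _ (curve_nontrivial Tt).
- exact: countable_coords.
- by move=> p; exact: flat_in_coords.
have xtr : rk set0 (coords_of x ++ coords_of t) = (3 * d)%N.
  by rewrite rank_catC rank_cat0 tr xr -{2}(mul1n d) -mulnDl.
(* x is generic in the plane: dim(xt) = 3d, and the curve of indices at x leaves t at most d over
   x. *)
exists x, t; split=> //; apply/eqP; rewrite eqn_leq acl_rank_pair /=.
have h := indices_rank_le Tt Ctx (@subset_refl _ _).
move: xtr; rewrite rank_cat0 mulSn addnC => xtr.
by rewrite -(leq_add2l d) -xtr leq_add2r.
Qed.

Lemma dim_set_plane : dim_set S (reals set0) (range (@flat K n M 'I_2)) = (2 * d)%N.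
Proof.
have [x [t [_ _ xr _ _]]] := generic_incidence.
apply: dim_setE => // [_ [y _ <-]|]; first by rewrite dim_flat acl_rank_pair.
by exists (flat x); [exists x|rewrite dim_flat].
Qed.

Lemma dim_set_base : dim_set S (reals set0) (base (flat_family C)) = (2 * d)%N.
Proof.
have [x [t [Tt _ _ tr _]]] := generic_incidence.
apply: dim_setE => // [_ [y _ <-]|]; first by rewrite dim_flat acl_rank_pair.
by exists (flat t); [exists t|rewrite dim_flat].
Qed.

Lemma graph_flatP (z : 'I_2 * 'I_n + 'I_2 * 'I_n -> K) : graph (flat_family C) z <->
  exists x t, [/\ base C t, C t x & z = tcat (flat x) (flat t)].
Proof.
split=> [[[t Tt tz] [t' [x [tz' xz Ctx]]]]|[x [t [Tt Ctx ->]]]]; last first.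
  by split; [exists t|exists t, x].
exists x, t; split=> //; last by apply: tcat_eq => i; [rewrite -xz|rewrite tz].
by move: tz' Ctx; rewrite -tz => /flat_inj ->.
Qed.

Lemma dim_set_graph : dim_set S (reals set0) (graph (flat_family C)) = (3 * d)%N.
Proof.
have [x [t [Tt Ctx _ _ xtr]]] := generic_incidence.
apply: dim_setE => // [z /graph_flatP[x' [t' [Tt' Ctx' ->]]]|].
  by rewrite dim_tcat_flat graph_rank_le.
by exists (tcat (flat x) (flat t)); [apply/graph_flatP; exists x, t|rewrite dim_tcat_flat].
Qed.

Lemma definable_flat_curve t (B : set K) : base C t -> (forall p, B (flat t p)) ->
  definable_over S (reals B) (@flat K n M 'I_2 @` C t).
Proof.
move=> Tt tB; have [psi psiP] := flat_formula phiG.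
apply/definable_over_realsP; exists ('I_2 * 'I_n)%type, psi, (flat t); split=> //.
apply/seteqP; split=> y; rewrite /mkset psiP.
  by move=> [x Ctx <-]; exists x => //; apply/phiGP.
by move=> [x -> /phiGP[_ Ctx]]; exists x.
Qed.

Lemma definable_flat_indices x (B : set K) : (forall p, B (flat x p)) ->
  definable_over S (reals B) (@flat K n M 'I_2 @` indices_at C x).
Proof.
move=> xB; have [psi psiP] := flat_formula phiG'.
apply/definable_over_realsP; exists ('I_2 * 'I_n)%type, psi, (flat x); split=> //.
apply/seteqP; split=> y; rewrite /mkset psiP.
  by move=> [t Ctx <-]; exists t => //; apply/phiG'P.
by move=> [t -> /phiG'P Ctx]; exists t.
Qed.

Lemma dim_set_flat_curve t (B : set K) : countable B -> base C t ->
  [set` coords (coords_of t)] `<=` B ->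
  dim_set S (reals B) (@flat K n M 'I_2 @` C t) = d.
Proof.
move=> cB Tt tB; apply: dim_setE => // [_ [x Ctx <-]|].
  by rewrite dim_flat (curve_rank_le Tt).
have [|x /phiGP[_ Ctx] xr] := @nontrivial_curve_generic _ phiG t B cB _ (curve_nontrivial Tt).
  by move=> p; apply/tB/flat_in_coords.
by exists (flat x); [exists x|rewrite dim_flat].
Qed.

Lemma dim_set_flat_indices x t (B : set K) : countable B -> base C t -> C t x ->
  [set` coords (coords_of x)] `<=` B ->
  dim_set S (reals B) (@flat K n M 'I_2 @` indices_at C x) = d.
Proof.
move=> cB Tt Ctx xB; apply: dim_setE => // [_ [u [Tu Cux] <-]|].
  by rewrite dim_flat (indices_rank_le Tu Cux).
have [|u /phiG'P[Tu Cux] ur] := @nontrivial_curve_generic _ phiG' x B cB _ (indices_nontrivial Tt Ctx).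
  by move=> p; apply/xB/flat_in_coords.
by exists (flat u); [exists u|rewrite dim_flat].
Qed.

Lemma weakly_genericP x t u : base C t -> C t x -> base C u -> C u x ->
  weakly_generic_intersection S (reals set0) (range (@flat K n M 'I_2))
    (flat_family C) (flat_family C) (flat x, flat t, flat u) <->
  [/\ rk set0 (coords_of x) = (2 * d)%N, rk set0 (coords_of t) = (2 * d)%N,
      rk set0 (coords_of u) = (2 * d)%N,
      rk set0 (coords_of x ++ coords_of t) = (3 * d)%N &
      rk set0 (coords_of x ++ coords_of u) = (3 * d)%N].
Proof.
move=> Tt Ctx Tu Cux; rewrite /weakly_generic_intersection /generic.
rewrite dim_set_plane dim_set_base dim_set_graph !dim_tcat_flat !dim_flat.
split=> [[[_ ?] [_ ?] [_ ?] [_ ?] [_ ?]]//|[? ? ? ? ?]]; split; split=> //.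
- by exists t.
- by exists u.
- by apply/graph_flatP; exists x, t.
- by apply/graph_flatP; exists x, u.
Qed.

(** * Generic intersections of the family with itself *)

Hypothesis hgS : hausdorff_geometric S.

Lemma adjoin_flat x :
  adjoin (reals set0) (flat x) = reals [set` coords (coords_of x)].
Proof. by rewrite /adjoin reals0 set0U range_flat. Qed.

(* Two curves through x meet in a finite set, which puts x in acl(t, u), or in
   an infinite one, which by almost faithfulness puts u in acl(t). *)
Lemma incidence_rank_drop t u x : base C t -> base C u -> C t x -> C u x ->
  rk [set` coords (coords_of t ++ coords_of u)] (coords_of x) = 0%N \/
  rk [set` coords (coords_of t)] (coords_of u) = 0%N.
Proof.
move=> Tt Tu Ctx Cux; have [fin|inf] := EM (finite_set (C t `&` C u)).
  by left; apply: (finite_intersection_rank Tt Tu).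
by right; apply: (infinite_intersection_rank Tt Tu).
Qed.

(** Density of generics on the set of indices at x: t is generic there over x, and a nearby index
    can be made generic over x and t. *)
Lemma generic_nearby_index x t : base C t -> C t x ->
  rk [set` coords (coords_of x)] (coords_of t) = d ->
  forall W, nbhs (flat t : {ptws _ -> K}) W ->
  exists u, [/\ W (flat u), base C u, C u x &
    rk [set` coords (coords_of x ++ coords_of t)] (coords_of u) = d].
Proof.
move=> Tt Ctx txd W hW.
have [||s Ws [[u [Tu Cux] us]]] := hg_generic hgS (countable_coords (coords_of x))
  (countable_coords (coords_of x ++ coords_of t)) _
  (definable_flat_indices (flat_in_coords_set x)) _ hW.
- by rewrite coords_set_cat; exact: subsetUl.
- split; first by exists t.
  rewrite dim_flat (dim_set_flat_indices _ Tt Ctx) //; exact: countable_coords.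
rewrite -us in Ws *; rewrite dim_flat (dim_set_flat_indices _ Tt Ctx).
- by move=> ud; exists u.
- exact: countable_coords.
- by rewrite coords_set_cat; exact: subsetUl.
Qed.

Lemma generic_nearby_point x t : base C t -> C t x ->
  rk [set` coords (coords_of t)] (coords_of x) = d ->
  forall W, nbhs (flat x : {ptws _ -> K}) W ->
  exists y, [/\ W (flat y), C t y &
    rk [set` coords (coords_of t ++ coords_of x)] (coords_of y) = d].
Proof.
move=> Tt Ctx xtd W hW.
have [||s Ws [[y Cty us]]] := hg_generic hgS (countable_coords (coords_of t))
  (countable_coords (coords_of t ++ coords_of x)) _
  (definable_flat_curve Tt (flat_in_coords_set t)) _ hW.
- by rewrite coords_set_cat; exact: subsetUl.
- split; first by exists x.
  rewrite dim_flat (dim_set_flat_curve _ Tt) //; exact: countable_coords.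
rewrite -us in Ws *; rewrite dim_flat (dim_set_flat_curve _ Tt).
- by move=> ud; exists y.
- exact: countable_coords.
- by rewrite coords_set_cat; exact: subsetUl.
Qed.

Lemma rank_cond l l' a b : rk set0 l = a -> rk set0 (l ++ l') = (a + b)%N ->
  rk [set` coords l] l' = b.
Proof. by rewrite rank_cat0 => -> /addnI. Qed.

Lemma diagonal_strongly_approximable x t : base C t -> C t x ->
  rk set0 (coords_of x) = (2 * d)%N -> rk set0 (coords_of t) = (2 * d)%N ->
  rk set0 (coords_of x ++ coords_of t) = (3 * d)%N ->
  strongly_approximable S (reals set0) (range (@flat K n M 'I_2))
    (flat_family C) (flat_family C) (flat x, flat t, flat t).
Proof.
move=> Tt Ctx xr tr xtr W [[P Q] [/= hP hQ] PQ].
have txd : rk [set` coords (coords_of x)] (coords_of t) = d.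
  by apply: rank_cond xr _; rewrite xtr -{3}(mul1n d) -mulnDl.
(* Only the second index moves; x and the first index stay. *)
have [u [Qu Tu Cux ud]] := generic_nearby_index Tt Ctx txd hQ.
exists (flat x, flat t, flat u).
  by apply: PQ; split=> //; exact: nbhs_singleton hP.
have uxd : rk [set` coords (coords_of x)] (coords_of u) = d.
  apply/eqP; rewrite eqn_leq (indices_rank_le Tu Cux (@subset_refl _ _)) /=.
  by rewrite -{1}ud; apply: acl_rank_mono; rewrite coords_set_cat; exact: subsetUl.
have xur : rk set0 (coords_of x ++ coords_of u) = (3 * d)%N.
  by rewrite rank_cat0 xr uxd -{2}(mul1n d) -mulnDl.
have xtur : rk set0 (coords_of x ++ (coords_of t ++ coords_of u)) = (4 * d)%N.
  by rewrite catA rank_cat0 xtr ud -{2}(mul1n d) -mulnDl.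
have ur : rk set0 (coords_of u) = (2 * d)%N.
  apply/eqP; rewrite eqn_leq acl_rank_pair /=.
  have h := curve_rank_le Tu Cux (@subset_refl _ _).
  by move: xur; rewrite rank_catC rank_cat0 mulSn addnC => xur; rewrite -(leq_add2l d) -xur leq_add2r.
split.
- exact/weakly_genericP.
- rewrite /independent dim_tcat_flat !dim_flat tr ur -mulnDl.
  move: xtur; rewrite rank_catC rank_cat0.
  have [->|h] := incidence_rank_drop Tt Tu Ctx Cux; first by rewrite addn0.
  (* If u were algebraic over t, its dimension d over x and t would be 0. *)
  have : (d <= 0)%N.
    rewrite -h -{1}ud; apply: acl_rank_mono; rewrite coords_set_cat; exact: subsetUr.
  by rewrite leqNgt d_gt0.
- by rewrite /independent adjoin_flat dim_tcat_flat !dim_flat rank_cat txd ud uxd.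
Qed.

(** The second point is taken generic on C_t over t and x; as d > 0 it differs from x, and both
    points lie over (t, t). *)
Lemma diagonal_multiple_intersection x t : base C t -> C t x ->
  rk set0 (coords_of x) = (2 * d)%N -> rk set0 (coords_of t) = (2 * d)%N ->
  rk set0 (coords_of x ++ coords_of t) = (3 * d)%N ->
  generic_multiple_intersection S (reals set0) (range (@flat K n M 'I_2))
    (flat_family C) (flat_family C) (flat x, flat t, flat t).
Proof.
move=> Tt Ctx xr tr xtr; split; first exact/weakly_genericP.
have inI y : C t y -> intersections (flat_family C) (flat_family C) (flat y, flat t, flat t).
  by move=> Cty; split; apply/graph_flatP; exists y, t.
split; first exact: inI.
move=> W [[P Q] [/= hP hQ] PQ].
(* The product is nested as ((x, t), t), and [P1] will be the factor at x. *)
have [[P' P''] [/= hP' hP''] P'P] := hP.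
have [[P1 P2] [/= hP1 hP2] P12] := hP'.
have xtd : rk [set` coords (coords_of t)] (coords_of x) = d.
  by apply: rank_cond tr _; rewrite rank_catC xtr -{3}(mul1n d) -mulnDl.
have [y [P1y Cty yd]] := generic_nearby_point Tt Ctx xtd hP1.
exists ((flat y, flat t, flat t), (flat x, flat t, flat t)); split.
  split; [exact: inI|exact: inI| |by []].
  move=> /= -[/flat_inj yx]; move: yd; rewrite yx.
  rewrite acl_rank_eq0; first by move=> d0; have := d_gt0; rewrite -d0.
  by move=> z zx; apply: acl_mem; rewrite coords_set_cat; right.
apply: PQ; split; last exact: nbhs_singleton hQ.
apply: P'P; split; last exact: nbhs_singleton hP''.
by apply: P12; split=> //; exact: nbhs_singleton hP2.
Qed.

(** By contraposition: dim(tu) > 3d is exactly what [tuple_rank_max] needs to give the pair rank 4 =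
    2 + 2. *)
Lemma dependent_rank_le t u : rk set0 (coords_of t) = (2 * d)%N ->
  rk set0 (coords_of u) = (2 * d)%N -> ~ rank_independent SM set0 t u ->
  (rk set0 (coords_of t ++ coords_of u) <= 3 * d)%N.
Proof.
move=> tr ur dep; rewrite leqNgt; apply/negP => hr; apply: dep.
have h (v : 'I_2 -> set_type M) : rk set0 (coords_of v) = (2 * d)%N -> tuple_rank SM set0 v 2.
  move=> vr; have := @tuple_rank_max _ v; rewrite card_ord; apply.
  by rewrite vr -[ltnLHS]addn0 ltn_add2l d_gt0.
exists 2, 2; split; [exact: h|exact: h|].
have := @tuple_rank_max _ (tcat t u); rewrite card_sum card_ord; apply.
have -> : rk set0 [seq tcat t u j | j <- enum {: 'I_2 + 'I_2}] =
    rk set0 (coords_of t ++ coords_of u).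
  apply: acl_rank_perm => //; apply: perm_flatten.
  have -> : coords_of t ++ coords_of u = [seq tcat t u k | k <-
    [seq inl i | i <- enum 'I_2] ++ [seq inr j | j <- enum 'I_2]].
    by rewrite map_cat -!map_comp.
  by apply: perm_map; apply: perm_map; exact: enum_sum_perm.
by rewrite -[(2 + 2)%N]/(1 + 3)%N mulnDl mul1n addnC ltn_add2r.
Qed.

Lemma excellent_family_dim_le1 : detects_multiple_intersections S SM ->
  ramification_purity S -> (d <= 1)%N.
Proof.
move=> detect pure.
have [x0 [t0 [Tt0 Ctx0 xr0 tr0 xtr0]]] := generic_incidence.
have defG : definable_family S (reals set0) (flat_family C).
  have defT : definable_over S (reals set0) (base (flat_family C)).
    rewrite reals0; apply: zero_def; apply/definable_over0P; exists phiT.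
    by apply/seteqP; split=> t /phiTP.
  split=> //; rewrite reals0 in defT *.
  have /definable_over0P[p pE] := defT.
  have [psi psiP] := flat_formula phiG.
  (* [psiP] describes [psi] only at tuples whose second half is flat, which the conjunct for the
     base guarantees. *)
  apply/definable_over0P; exists (And psi (rename inr p)).
  apply/seteqP; split=> z.
    move=> /graph_flatP[x [t [Tt Ctx ->]]]; apply/sat_And; split.
      by apply/psiP; exists x => //; apply/phiGP.
    apply/sat_rename; have : base (flat_family C) (flat t) by exists t.
    by rewrite pE.
  move=> /sat_And[h1 /sat_rename h2].
  have [t _ tz] : base (flat_family C) (z \o inr) by rewrite pE.
  apply/graph_flatP.
  have zE : z = tcat (z \o inl) (flat t) by apply: tcat_eq => // j; rewrite tz.
  move: h1; rewrite zE => /psiP[x xz /phiGP[Tt Ctx]].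
  by exists x, t; split=> //; rewrite -xz.
have defX : definable_over S (reals set0) (range (@flat K n M 'I_2)).
  rewrite reals0; apply: zero_def; apply/definable_over0P; exists (Neg Falsum).
  by apply/seteqP; split=> // y _ [].
have subX s : base (flat_family C) s -> flat_family C s `<=` range (@flat K n M 'I_2).
  by move=> _ y [t [x [_ -> _]]]; exists x.
have [|[[y s] r] gm cod] := pure set0 _ _ _ _ _ _ (countable0 K) defX defG defG subX subX.
  exists (flat x0, flat t0, flat t0).
    exact: diagonal_multiple_intersection.
  exact: diagonal_strongly_approximable.
(* Purity returns tuples of K; membership in the two graphs shows that they come from points of M,
   and the shared first component gives a single x. *)
have [[_ _ _ [/graph_flatP[x [t [Tt Ctx yst]]] _] [/graph_flatP[x' [u [Tu Cux ysu]]] _]] _] := gm.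
have yx : y = flat x by apply: funext => i; exact: (congr1 (fun f => f (inl i)) yst).
have st : s = flat t by apply: funext => i; exact: (congr1 (fun f => f (inr i)) yst).
have ru : r = flat u by apply: funext => i; exact: (congr1 (fun f => f (inr i)) ysu).
have xx' : x' = x.
  apply: flat_inj; rewrite -yx; apply: funext => i.
  by have := congr1 (fun f => f (inl i)) ysu.
rewrite {}xx' {ysu yst} in Cux; rewrite {}yx {}st {}ru in gm cod.
have [/weakly_genericP - /(_ Tt Ctx Tu Cux)[xr tr ur xtr xur] _] := gm.
(* Detection applies because an excellent family is standard with r = 2: its sets of indices at a
   point have rank 1 or are empty. *)
have dep : ~ rank_independent SM set0 t u.
  apply: (detect set0 2 2 C C x t u) => //.
  - have [dC faith rkT nt idx] := exC; split=> //.
    + by move=> v /nt[].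
    + by move=> v; have [->|[[_ []]]//] := idx v; move=> /rank_ge_full[l _ /full_nonempty[]].
  - have [dC faith rkT nt idx] := exC; split=> //.
    + by move=> v /nt[].
    + by move=> v; have [->|[[_ []]]//] := idx v; move=> /rank_ge_full[l _ /full_nonempty[]].
  - by rewrite image_set0 -reals0.
have tu3 := dependent_rank_le tr ur dep.
have txd : rk [set` coords (coords_of x)] (coords_of t) = d.
  by apply: rank_cond xr _; rewrite xtr -{3}(mul1n d) -mulnDl.
have uxd : rk [set` coords (coords_of x)] (coords_of u) = d.
  by apply: rank_cond xr _; rewrite xur -{3}(mul1n d) -mulnDl.
(* Codimension at most 1 now reads 2d <= dim(tu/x) + 1. *)
move: cod; rewrite /codim adjoin_flat dim_tcat_flat !dim_flat txd uxd leq_subLR => cod.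
have le3 : (rk set0 (coords_of x ++ (coords_of t ++ coords_of u)) <= 3 * d)%N.
  (* Either dim(xtu) = dim(tu), bounded by dependence, or u is algebraic over t and dim(xtu) =
     dim(xt). *)
  have [h|h] := incidence_rank_drop Tt Tu Ctx Cux.
    by rewrite rank_catC rank_cat0 h addn0.
  rewrite catA rank_cat0 xtr -[leqRHS]addn0 leq_add2l.
  by apply: leq_trans (eq_leq h); apply: acl_rank_mono; rewrite coords_set_cat; exact: subsetUr.
(* Subtracting dim(x) = 2d leaves dim(tu/x) <= d, whence 2d <= d + 1. *)
move: le3; rewrite rank_cat0 xr -[3]/(2 + 1)%N mulnDl mul1n leq_add2l => le1.
by rewrite -(leq_add2l d) (leq_trans cod) // leq_add2r.
Qed.

End Family.

End Relic.

Theorem theorem5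
    (L : language) (K : topologicalType) (SK : structure L K)
    (n : nat) (M : set ('I_n -> K))
    (LM : language) (SM : structure LM (set_type M)) :
  hausdorff_geometric SK ->
  definable_relic SK SM ->
  strongly_minimal SM ->
  not_locally_modular SM ->
  zero_definable_sets_are_zero_definable SK SM ->
  countable_language LM ->
  infinite_set [set b | acl SM set0 b]%classic ->
  (exists C : set_family (set_type M) 'I_2 'I_2, excellent_family SM set0%classic C) ->
  detects_multiple_intersections SK SM ->
  ramification_purity SK ->
  dim_set SK set0%classic M = 1.
Proof.
move=> hgK _ smM _ zeroM _ infacl [C exC] detect pure.
have infM : infinite_set [set: set_type M].
  by apply: contra_not infacl; apply: sub_finite_set.
have geoK := hg_geometric hgK; have satK := hg_saturated hgK.
apply/eqP; rewrite eqn_leq (d_gt0 geoK satK zeroM infM) andbT.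
have [[/definable_over0P[phiT TE] /definable_over0P[phiG GE]] _ _ _ _] := exC.
apply: (excellent_family_dim_le1 geoK satK smM zeroM infM exC (phiT := phiT)
  (phiG := phiG)) => // [t|x t]; first by rewrite TE.
by rewrite -[sat _ _ _]/([set z | sat SM phiG z] (tcat x t)) -GE.
Qed.
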